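(* Let $q\in\mathbb{N}$, let $H$ be a separable Hilbert space, and let $R\in\mathcal{L}(H)$ satisfy the $q$-FHC Criterion. Let $U\in\mathcal{L}(H)$ be a unitary operator. Then the operators $C_R$, $C_R(S)=RSR^*$, and $C_{R,U}$, $C_{R,U}(S)=RSU$, are $q$-frequently hypercyclic on $(\mathcal{K}(H),\|\cdot\|_{op})$ and on $(\mathcal{L}(H),\mathrm{COT})$.
   Context: $\mathcal{L}(H)$ and $\mathcal{K}(H)$ are the spaces of bounded and of compact operators on $H$; $\|\cdot\|_{op}$ is the operator norm; COT is the topology of uniform convergence on compact subsets of $H$. A continuous linear operator $A$ on a topological vector space $E$ is $q$-frequently hypercyclic if there is $x\in E$ such that for every non-empty open $V\subset E$ the set $M=\{n\in\mathbb{N}: A^nx\in V\}$ satisfies $\liminf_{N\to\infty}\frac{\mathrm{card}\{n\in M:\ n\le N^q\}}{N}>0$. $q$-FHC Criterion: a bounded operator $R$ on a separable Banach space $X$ satisfies the $q$-FHC Criterion if there is a dense set $D\subset X$ such that for each $x\in D$ there is a sequence $(x_n)_{n\ge0}$ in $X$ with $x_0=x$ and (a) $\sum_{n=0}^{r}R^{r^q-(r-n)^q}(x)$ converges unconditionally, uniformly in $r\ge0$; (b) $\sum_{n\ge0}x_{(n+r)^q-r^q}$ converges unconditionally, uniformly in $r\ge0$; (c) $R^{n^q}x_{n^q}=x$ and $R^{n^q}x_{m^q}=x_{m^q-n^q}$ for $m>n\ge0$. Here $\sum_n x_{n,r}$ converges unconditionally uniformly in $r$ if for every $\delta>0$ there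 is $N$ with $\|\sum_{n\in F}x_{n,r}\|<\delta$ for all finite $F\subset[N,\infty)$ and all $r$ (terms with $n>r$ are $0$ in the sums $\sum_{n=0}^r$). *)

(* Defs.v *)
From HB Require Import structures.
From mathcomp Require Import all_boot all_order all_algebra finmap complex.
From mathcomp Require Import all_classical all_reals all_analysis.

Set Implicit Arguments.
Unset Strict Implicit.
Unset Printing Implicit Defensive.

Import Order.TTheory GRing.Theory Num.Theory.
Import numFieldNormedType.Exports.

Local Open Scope classical_set_scope.
Local Open Scope ring_scope.

Definition separable (T : topologicalType) : Prop :=
  exists2 D : set T, countable D & dense D.

(* Lower q-density: liminf_N card {n in M, 1 <= n <= N^q} / N.  The term N = 0
   is 0 / 0 = 0 in the library and does not affect the inferior limit. *)
Definition lower_qdensity (R : realType) (q : nat) (M : set nat) : \bar R :=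
  limn_einf (fun N : nat =>
    ((\sum_(1 <= n < (N ^ q).+1) (n \in M))%N%:R / N%:R : R)%:E).

Definition q_frequently_hypercyclic (R : realType) (K : numFieldType)
    (E : topologicalLmodType K) (q : nat) (A : E -> E) : Prop :=
  [/\ linear A, continuous A &
      exists x : E, forall V : set E, open V -> V !=set0 ->
        (0 < lower_qdensity R q [set n | V (iter n A x)])%E].

Section bounded_operators.
Variables (K : numFieldType) (X : normedModType K).

Definition bounded_linear : {pred X -> X} :=
  [pred f : X -> X | `[< linear f /\
     exists M : K, forall x, `|f x| <= M * `|x| >]].

Record bounded_op := BoundedOp {
  bop_fun :> X -> X;
  bop_funP : bop_fun \in bounded_linear
}.

HB.instance Definition _ := [isSub for bop_fun].
HB.instance Definition _ := [Choice of bounded_op by <:].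

Lemma bounded_linear_submod_closed : submod_closed bounded_linear.
Proof.
split.
  apply/asboolP; split; first by move=> a x y; rewrite scaler0 addr0.
  by exists 0 => x; rewrite normr0 mul0r.
move=> a f g /asboolP[lf [M fM]] /asboolP[lg [N gN]]; apply/asboolP; split.
  move=> b x y; rewrite /= !fctE lf lg !scalerDr !scalerA [a * b]mulrC.
  by rewrite addrACA.
exists (`|a| * M + N) => x; rewrite fctE (le_trans (ler_normD _ _))//.
by rewrite mulrDl lerD// normrZ -mulrA ler_wpM2l.
Qed.

HB.instance Definition _ :=
  GRing.isSubmodClosed.Build K (X -> X) bounded_linear
    bounded_linear_submod_closed.
HB.instance Definition _ := [SubChoice_isSubLmodule of bounded_op by <:].

Lemma bop_linear (f : bounded_op) : linear f.
Proof. by have /asboolP[] := bop_funP f. Qed.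

Lemma bop_bounded (f : bounded_op) :
  exists2 M : K, 0 <= M & forall x, `|f x| <= M * `|x|.
Proof.
have /asboolP[_ [M fM]] := bop_funP f.
have [[x x0]|X0] := pselect (exists x : X, x != 0).
  exists M => //; have /(le_trans (normr_ge0 _)) := fM x.
  by rewrite pmulr_lge0// normr_gt0.
exists 0 => // x; have [->|x0] := eqVneq x 0; last by case: X0; exists x.
have := bop_linear f (-1) 0 0; rewrite !scaleN1r !addNr => ->.
by rewrite !normr0 mulr0.
Qed.

HB.instance Definition _ (f : bounded_op) :=
  GRing.isLinear.Build K X X *:%R (bop_fun f) (bop_linear f).

Lemma bop_continuous (f : bounded_op) : continuous f.
Proof.
apply: bounded_linear_continuous; have [M M0 fM] := bop_bounded f.
apply/ex_bound; exists M; apply/nbhs_norm0P; exists 1 => //= x /= x1.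
by rewrite (le_trans (fM x))// ler_piMr// ltW.
Qed.

Lemma bop_comp_subproof (f g : bounded_op) :
  (f : X -> X) \o g \in bounded_linear.
Proof.
apply/asboolP; split; first by move=> a x y; rewrite /= !linearP.
have [[M M0 fM] [N N0 gN]] := (bop_bounded f, bop_bounded g).
exists (M * N) => x /=.
by rewrite (le_trans (fM _))// -mulrA ler_wpM2l.
Qed.

Definition bop_comp (f g : bounded_op) : bounded_op :=
  BoundedOp (bop_comp_subproof f g).

Definition compact_operator : {pred bounded_op} :=
  [pred f : bounded_op | `[< precompact (f @` [set x | `|x| <= 1]) >]].

Record compact_op := CompactOp {
  cop_bop :> bounded_op;
  cop_bopP : cop_bop \in compact_operator
}.

HB.instance Definition _ := [isSub for cop_bop].
HB.instance Definition _ := [Choice of compact_op by <:].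

Lemma precompactS_compact (A B : set X) :
  A `<=` B -> compact B -> precompact A.
Proof.
move=> AB cB; apply: precompact_subset AB _.
by rewrite precompact_closed//; apply: compact_closed cB; exact: norm_hausdorff.
Qed.

Lemma compact_operator_submod_closed : submod_closed compact_operator.
Proof.
split.
  apply/asboolP; apply: (@precompactS_compact _ [set 0]).
    by move=> _ [x _ <-].
  exact: compact_set1.
move=> a f g /asboolP cf /asboolP cg; apply/asboolP.
rewrite precompactE in cf; rewrite precompactE in cg.
set A := closure _ in cf; set B := closure _ in cg.
apply: (@precompactS_compact _
  ((fun z : X * X => a *: z.1 + z.2) @` (A `*` B))).
  move=> _ [x x1 <-]; exists (f x, g x) => //.
  by split; apply: subset_closure; exists x.
apply: continuous_compact; last exact: compact_setX.
apply: continuous_subspaceT => z.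
by apply: cvgD; [apply: cvgZr; exact: cvg_fst|exact: cvg_snd].
Qed.

HB.instance Definition _ :=
  GRing.isSubmodClosed.Build K bounded_op compact_operator
    compact_operator_submod_closed.
HB.instance Definition _ := [SubChoice_isSubLmodule of compact_op by <:].

Lemma cop_comp_subproof (R T : bounded_op) (S : compact_op) :
  bop_comp (bop_comp R S) T \in compact_operator.
Proof.
have := cop_bopP S => /asboolP; rewrite precompactE => cS; apply/asboolP.
have [M M0 TM] := bop_bounded T; have M1 : 0 < M + 1 by rewrite ltr_wpDl.
apply: (@precompactS_compact _
  ((fun y => (M + 1) *: R y) @` closure (S @` [set x | `|x| <= 1]))).
  move=> _ [x /= x1 <-]; exists (S ((M + 1)^-1 *: T x)).
    apply: subset_closure; exists ((M + 1)^-1 *: T x) => //=.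
    rewrite normrZ gtr0_norm ?invr_gt0// ler_pdivrMl// mulr1.
    by rewrite (le_trans (TM x))// (@le_trans _ _ M) ?ler_piMr// lerDl.
  by rewrite !linearZ/= scalerA mulVf ?scale1r// gt_eqF.
apply: continuous_compact => //; apply: continuous_subspaceT => y.
by apply: cvgZr; exact: bop_continuous.
Qed.

(* L(H) itself carries no topology; the alias cot_op carries the topology of
   uniform convergence on compact sets. *)
Definition cot_fun (f : bounded_op) : {family compact, X -> X} := f.
Definition cot_op : Type := initial_topology cot_fun.

HB.instance Definition _ := GRing.Lmodule.copy cot_op bounded_op.
HB.instance Definition _ := Uniform.copy cot_op (initial_topology cot_fun).

Lemma cot_nbhsP (f : cot_op) (U : set cot_op) :
  nbhs f U <-> exists C : set X, exists2 e : K, compact C /\ 0 < e &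
    [set g : cot_op | forall x, C x -> `|f x - g x| < e] `<=` U.
Proof.
pose P (p : set X * K) :=
  [set g : cot_op | forall x, p.1 x -> `|f x - g x| < p.2].
pose D := [set p : set X * K | compact p.1 /\ 0 < p.2].
split=> [fU|[C [e [cC e0] PU]]]; last first.
  apply: (filterS PU).
  have eE : entourage [set z : X * X | `|z.1 - z.2| < e].
    by rewrite -entourage_from_ballE; exists e => // z; rewrite -ball_normE.
  exact: (@initial_continuous _ _ cot_fun f _
    (@fam_nbhs X X compact C _ (cot_fun f) eE cC)).
have FF : Filter (filter_from D P).
  apply: filter_from_filter.
    by exists (set0, 1); split => //; exact: compact0.
  move=> [A a] [B b] [/= cA a0] [/= cB b0].
  have ab : (a >=< b)%O by rewrite real_comparable ?gtr0_real.
  exists (A `|` B, Num.min a b).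
    by split; [exact: compactU|rewrite comparable_lt_min ?a0].
  move=> g /= gP; split=> x /= Hx.
    by have := gP x (or_introl Hx); rewrite comparable_lt_min// => /andP[].
  by have := gP x (or_intror Hx); rewrite comparable_lt_min// => /andP[].
have : {family compact,
    (fun g : cot_op => (g : X -> X)) @ filter_from D P --> (f : X -> X)}.
  apply/fam_cvgP => A cA V /uniform_nbhs[E [entE EV]].
  move: entE; rewrite -entourage_from_ballE => -[e /= e0 eE].
  exists (A, e) => // g gP; apply: EV => x Ax; apply: eE.
  by rewrite /= -ball_normE; exact: gP.
move: fU => [_ [[B oB <-] Bf BU]] /(_ B)[]; first exact: open_nbhs_nbhs.
move=> [C e] [cC e0] PB; exists C, e => //.
exact: subset_trans BU.
Qed.

Lemma compact_norm_le (C : set X) : compact C ->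
  exists2 M : K, 0 < M & forall x, C x -> `|x| <= M.
Proof.
move=> /compact_near_coveringP cC.
have [|M [Mr CM]] := cC K +oo (fun M x => `|x| <= M) _.
  move=> x _; exists ([set y | `|y| < `|x| + 1], [set M | `|x| + 1 < M]).
    split => /=; last by apply: nbhs_pinfty_gt; rewrite ger0_real.
    apply/nbhs_ballP; exists 1 => //= y; rewrite -ball_normE /= => xy.
    rewrite -[y](subKr x) (le_lt_trans (ler_normB _ _))//.
    by rewrite ltrD2l.
  by move=> [y M] /= [yx xM]; rewrite ltW// (lt_trans yx).
have M1 : M < `|M| + 1 by rewrite (le_lt_trans (real_ler_norm Mr))// ltrDl.
exists (`|M| + 1); first by rewrite ltr_wpDl.
exact: CM.
Qed.

Lemma cot_add_continuous : continuous (fun z : cot_op * cot_op => z.1 + z.2).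
Proof.
move=> [f g] U /cot_nbhsP[C [e [cC e0] CU]].
exists ([set f' : cot_op | forall x, C x -> `|f x - f' x| < e / 2],
        [set g' : cot_op | forall x, C x -> `|g x - g' x| < e / 2]) => /=.
  by split; apply/cot_nbhsP; exists C, (e / 2) => //; split=> //;
    rewrite divr_gt0.
move=> [f' g'] /= [ff' gg']; apply: CU => x Cx /=.
rewrite [X in `|X|](_ : _ = (f x - f' x) + (g x - g' x)); last first.
  by rewrite addrACA -opprD.
by rewrite (splitr e) (le_lt_trans (ler_normD _ _))// ltrD ?ff' ?gg'.
Qed.

Lemma cot_scale_continuous :
  continuous (fun z : K^o * cot_op => z.1 *: z.2).
Proof.
move=> [r f] U /cot_nbhsP[C [e [cC e0] CU]].
have [M M0 fM] : exists2 M : K, 0 < M & forall x, C x -> `|f x| <= M.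
  have [M M0 CM] := compact_norm_le cC; have [N N0 fN] := bop_bounded f.
  exists (N * M + 1); first by rewrite ltr_wpDl// mulr_ge0// ltW.
  move=> x Cx; rewrite (le_trans (fN x))// (@le_trans _ _ (N * M)) ?lerDl//.
  by rewrite ler_wpM2l// CM.
pose a := e / 2 / M; pose b := e / 2 / (`|r| + a).
have a0 : 0 < a by rewrite !divr_gt0.
have b0 : 0 < b by rewrite !divr_gt0// ltr_wpDl.
exists ([set s : K^o | `|r - s| < a],
        [set g : cot_op | forall x, C x -> `|f x - g x| < b]) => /=.
  split; last by apply/cot_nbhsP; exists C, b.
  by apply/nbhs_ballP; exists a => // s; rewrite -ball_normE.
move=> [s g] /= [rs fg]; apply: CU => x Cx /=.
rewrite [X in `|X|](_ : _ = (r - s) *: f x + s *: (f x - g x)); last first.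
  by rewrite scalerBl scalerBr addrA subrK.
rewrite (splitr e) (le_lt_trans (ler_normD _ _))// !normrZ ltr_leD//.
  rewrite (@le_lt_trans _ _ (`|r - s| * M))//; first by rewrite ler_wpM2l// fM.
  by rewrite -ltr_pdivlMr.
have sr : `|s| <= `|r| + a.
  by rewrite -[s](subrK r) addrC (le_trans (ler_normD _ _))// lerD2l distrC ltW.
rewrite (le_trans (ler_pM _ _ sr (ltW (fg x Cx))))//.
by rewrite mulrC divfK// gt_eqF// ltr_wpDl.
Qed.

HB.instance Definition _ :=
  PreTopologicalNmodule_isTopologicalNmodule.Build cot_op cot_add_continuous.
HB.instance Definition _ :=
  TopologicalNmodule_isTopologicalLmodule.Build K cot_op cot_scale_continuous.

End bounded_operators.

(* Uniform (in r) unconditional convergence of the series sum_n a r n. *)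
Definition unconditionally_uniformly (K : numFieldType) (X : normedModType K)
    (a : nat -> nat -> X) : Prop :=
  forall d : K, 0 < d -> exists N : nat, forall (F : {fset nat}) (r : nat),
    (forall n, n \in F -> (N <= n)%N) -> `|\sum_(n <- F) a r n| < d.

Definition qFHC_criterion (K : numFieldType) (X : completeNormedModType K)
    (q : nat) (T : bounded_op X) : Prop :=
  exists2 D : set X, dense D & forall x, D x -> exists u : nat -> X,
    [/\ u 0%N = x,
        unconditionally_uniformly (fun r n =>
          if (n <= r)%N then iter (r ^ q - (r - n) ^ q)%N T x else 0),
        unconditionally_uniformly (fun r n => u ((n + r) ^ q - r ^ q)%N),
        forall n, iter (n ^ q) T (u (n ^ q)%N) = x
      & forall n m, (n < m)%N ->
          iter (n ^ q) T (u (m ^ q)%N) = u (m ^ q - n ^ q)%N].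

(* Hilbert spaces may be real or complex: scalars R k is R or R[i]. *)
Variant scalar_kind := RealScalars | ComplexScalars.

Definition scalars (R : realType) (k : scalar_kind) : numFieldType :=
  match k with RealScalars => R | ComplexScalars => R[i]%C end.

Definition conj_scalar (R : realType) (k : scalar_kind) :
    scalars R k -> scalars R k :=
  match k with RealScalars => idfun | ComplexScalars => @conjc R end.

Definition of_real (R : realType) (k : scalar_kind) : R -> scalars R k :=
  match k with RealScalars => idfun | ComplexScalars => real_complex R end.

Section scalars_theory.
Variables (R : realType) (k : scalar_kind).

Lemma of_real0 : of_real k 0 = 0 :> scalars R k.
Proof. by case: k. Qed.

Lemma of_real_le (a b : R) : (of_real k a <= of_real k b) = (a <= b).
Proof. by case: k => //=; rewrite lecR. Qed.

Lemma ge0_of_real (z : scalars R k) : 0 <= z -> exists c, of_real k c = z.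
Proof.
move: z; case: k => z z0; first by exists z.
by exists (complex.Re z); exact: RRe_real (ger0_real z0).
Qed.

End scalars_theory.

Section operator_norm.
Variables (R : realType) (k : scalar_kind) (X : normedModType (scalars R k)).

(* The norm of X takes its values in the scalar field, whereas the supremum is
   taken in the realType R; of_real goes from R to the scalars. *)
Definition opnorm (f : bounded_op X) : scalars R k :=
  of_real k (sup [set c : R |
    exists2 x : X, `|x| <= 1 & of_real k c = `|f x|]).

Lemma opnorm_has_sup (f : bounded_op X) :
  has_sup [set c : R | exists2 x : X, `|x| <= 1 & of_real k c = `|f x|].
Proof.
split.
  by exists 0; exists 0; rewrite ?normr0 ?ler01// linear0 normr0 of_real0.
have [M M0 fM] := bop_bounded f; have [m mM] := ge0_of_real M0.
exists m => c [x x1 cx]; rewrite -(of_real_le k) mM cx (le_trans (fM x))//.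
by rewrite ler_piMr.
Qed.

Lemma le_opnorm (f : bounded_op X) (x : X) : `|x| <= 1 -> `|f x| <= opnorm f.
Proof.
move=> x1; have [c cx] := ge0_of_real (normr_ge0 (f x)).
rewrite -cx of_real_le; apply: ub_le_sup; last by exists x.
by have [] := opnorm_has_sup f.
Qed.

Lemma opnorm_le (f : bounded_op X) (M : scalars R k) :
  (forall x : X, `|x| <= 1 -> `|f x| <= M) -> opnorm f <= M.
Proof.
move=> fM; have [|m mM] := @ge0_of_real _ _ M.
  by rewrite (le_trans (normr_ge0 (f 0)))// fM// normr0.
rewrite -mM of_real_le; apply: ge_sup; first by have [] := opnorm_has_sup f.
by move=> c [x x1 cx]; rewrite -(of_real_le k) cx mM fM.
Qed.

Lemma opnormD (f g : bounded_op X) : opnorm (f + g) <= opnorm f + opnorm g.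
Proof.
apply: opnorm_le => x x1; rewrite (le_trans (ler_normD _ _))//.
by rewrite lerD// le_opnorm.
Qed.

Lemma opnorm_ge0 (f : bounded_op X) : 0 <= opnorm f.
Proof. by rewrite (le_trans (normr_ge0 (f 0)))// le_opnorm// normr0. Qed.

Lemma opnormZ (a : scalars R k) (f : bounded_op X) :
  opnorm (a *: f) = `|a| * opnorm f.
Proof.
have leZ b g : opnorm (b *: g) <= `|b| * opnorm g.
  by apply: opnorm_le => x x1; rewrite normrZ ler_wpM2l// le_opnorm.
apply/eqP; rewrite eq_le leZ/=.
have [->|a0] := eqVneq a 0; first by rewrite normr0 mul0r opnorm_ge0.
rewrite -ler_pdivlMl ?normr_gt0// -normfV.
by rewrite -{1}[f](scalerK a0) leZ.
Qed.

Lemma opnorm_eq0 (f : bounded_op X) : opnorm f = 0 -> f = 0.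
Proof.
move=> f0; apply/val_inj/funext => x /=.
have [->|x0] := eqVneq x 0; first by rewrite linear0.
have := @le_opnorm f (`|x|^-1 *: x); rewrite f0 linearZ/= !normrZ normfV.
rewrite normr_id mulVf ?normr_eq0// lexx => /(_ isT).
by rewrite pmulr_rle0 ?invr_gt0 ?normr_gt0// normr_le0 => /eqP.
Qed.

Lemma copnorm_eq0 (f : compact_op X) : opnorm f = 0 -> f = 0.
Proof. by move=> f0; apply: val_inj; exact: (opnorm_eq0 f0). Qed.

HB.instance Definition _ := @Lmodule_isNormed.Build (scalars R k)
  (compact_op X) (fun f => opnorm f)
  (fun f g => opnormD f g) (fun a f => opnormZ a f)
  copnorm_eq0.

End operator_norm.

(* The inner product is linear in its first argument and conjugate-linear in
   the second one.  That it induces the norm of H is not part of {dot _ for _}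
   and has to be assumed separately. *)
Section hilbert.
Variables (R : realType) (k : scalar_kind).
Variable H : completeNormedModType (scalars R k).
Variable ip : {dot H for @conj_scalar R k}.

Definition is_adjoint (A B : bounded_op H) : Prop :=
  forall x y, ip (A x) y = ip x (B y).

(* The adjoint is unique when it exists, and exists by the Riesz representation
   theorem; 0 is a junk value. *)
Definition adjoint (A : bounded_op H) : bounded_op H :=
  xget 0 [set B | is_adjoint A B].

Definition unitary (U : bounded_op H) : Prop :=
  (forall x, U (adjoint U x) = x) /\ (forall x, adjoint U (U x) = x).

End hilbert.

Section multipliers.
Variables (K : numFieldType) (X : normedModType K) (A B : bounded_op X).

Definition mult_compact (S : compact_op X) : compact_op X :=
  CompactOp (cop_comp_subproof A B S).

Definition mult_cot (S : cot_op X) : cot_op X :=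
  bop_comp (bop_comp A S) B.

End multipliers.

(* Main.v *)
Require Import Defs.
From HB Require Import structures.
From mathcomp Require Import all_boot all_order all_algebra finmap complex.
From mathcomp Require Import all_classical all_reals all_analysis.
From mathcomp Require Import zify ring lra.

Set Implicit Arguments.
Unset Strict Implicit.
Unset Printing Implicit Defensive.

Import Order.TTheory GRing.Theory Num.Theory.
Import numFieldNormedType.Exports.

Local Open Scope classical_set_scope.
Local Open Scope ring_scope.

(** The orbit of a finite rank operator under S |-> A S B splits into orbits of
    rank one operators: the rank one operator x (x) y : h |-> <h, y> x is sent
    to A x (x) B^* y.  If x runs over the dense set of the q-FHC Criterion,
    then the orbits of x under A are unconditionally summable, uniformly in r.
    Tensoring them with merely bounded orbits under B^* preserves this
    summability in operator norm: the value at h of a finite sum of a_n (x) b_n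
    is the sum of the a_n with the bounded coefficients <h, b_n>, and bounded
    coefficients cost only a factor 4 ([norm_sum_bounded_coef_le],
    [rank_one_unconditionally]).  For B = A^* the orbits under B^* = A are
    summable by the criterion, hence bounded; for B = U the operator B^* is an
    isometry.  So S |-> A S B has summable orbits on the operators of finite
    rank with factors in a countable dense set, and these are dense in K(H)
    ([finite_rank_seq_dense]).

    Summable orbits of the members of a dense sequence yield a q-frequently
    hypercyclic vector ([frequently_hypercyclic_vector]).  The vector is a sum
    of backward orbits indexed by the q-th powers of the points of disjoint
    sets of integers of positive lower density that are separated by prescribed
    distances ([separated_colouring]).  The sum exists because K(H) is complete
    ([compact_op_complete]).

    The result passes to L(H) with the topology of uniform convergence on
    compact sets, because K(H) maps continuously and densely into it
    ([cot_of_compact_dense]).  Both density statements rest on orthogonal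
    projections of finite rank that are uniformly close to the identity on a
    given compact set ([finite_rank_near_id]), and the adjoints come from the
    Riesz representation theorem ([riesz_representation]). *)

(** * Separated sets of positive lower density *)

Lemma sum_divn_exp2_le (n m : nat) : (\sum_(1 <= k < m.+1) n %/ 2 ^ k <= n)%N.
Proof.
suff : (\sum_(1 <= k < m.+1) n %/ 2 ^ k + n %/ 2 ^ m <= n)%N.
  by apply: leq_trans; exact: leq_addr.
elim: m => [|m IH]; first by rewrite big_nil expn0 divn1.
rewrite big_nat_recr//=; apply: leq_trans IH.
rewrite -addnA leq_add2l expnSr divnMA.
by move: (n %/ 2 ^ m)%N => b; lia.
Qed.

(** The dyadic valuation has bounded average, by Legendre's formula for the
    power of 2 in a factorial. *)
Lemma sum_logn2_le (n : nat) : (\sum_(t < n) logn 2 t.+1 <= n)%N.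
Proof.
rewrite (_ : \sum_(t < n) logn 2 t.+1 = logn 2 n`!)%N; last first.
  elim: n => [|n IH]; first by rewrite big_ord0 fact0 logn1.
  by rewrite big_ord_recr/= IH factS lognM ?fact_gt0// addnC.
by rewrite logn_fact//; exact: sum_divn_exp2_le.
Qed.

Lemma logn2_odd (v j : nat) : logn 2 (2 ^ v * j.*2.+1)%N = v.
Proof.
rewrite lognM ?expn_gt0// pfactorK// (@lognE 2 j.*2.+1) dvdn2/= odd_double/=.
by rewrite addn0.
Qed.

(** The colour of the s-th point depends on the 2-adic valuation v of s.+1 only,
    so every colour recurs along an arithmetic progression of indices.  A colour
    is used at v only if its radius is at most v (or is the radius of colour 0).
    Since valuations have bounded average, so do the radii, and the [p s], built
    from their partial sums, grow linearly: separation by arbitrarily large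
    radii is compatible with positive lower density of each colour. *)
Lemma separated_colouring (N : nat -> nat) : exists col p : nat -> nat,
  [/\ forall t s, (t < s)%N -> (p t + N (col t) < p s)%N /\
                               (p t + N (col s) < p s)%N,
      forall s, (s < p s)%N /\ (N (col s) < p s)%N
    & forall l, exists (a : nat) (f : nat -> nat),
        {homo f : i j / (i < j)%N} /\
        forall j, col (f j) = l /\ (p (f j) <= a * j.+1)%N].
Proof.
pose g v := if (N (logn 2 v.+1) <= v)%N then logn 2 v.+1 else 0%N.
have gN v : (N (g v) <= N 0%N + v)%N by rewrite /g; case: ifP; lia.
pose col s := g (logn 2 s.+1).
pose S s := (\sum_(t < s) N (col t))%N.
have SS s : S s.+1 = (S s + N (col s))%N by rewrite /S big_ord_recr.
have S_le t s : (t <= s)%N -> (S t <= S s)%N.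
  elim: s => [|s IH]; first by case: t.
  by rewrite leq_eqVlt SS => /predU1P[->|]; rewrite ?SS; lia.
have Slin s : (S s <= (N 0%N).+1 * s)%N.
  rewrite (@leq_trans (\sum_(t < s) (N 0%N + logn 2 t.+1)))%N//.
    by apply: leq_sum => t _; exact: gN.
  rewrite big_split/= sum_nat_const card_ord.
  by rewrite mulSn addnC mulnC leq_add2r sum_logn2_le.
(* consecutive points differ by more than the sum of their two radii *)
exists col, (fun s => s.+1 + S s.+1 + S s)%N; split.
- move=> t s ts; have := S_le t.+1 s ts; have := S_le t s (ltnW ts).
  by rewrite !SS; lia.
- by move=> s; rewrite !SS; lia.
(* g v = l, since v.+1 has 2-adic valuation l and v is at least N l *)
- move=> l; pose v := (2 ^ l * (N l).*2.+1).-1.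
  have v1 : v.+1 = (2 ^ l * (N l).*2.+1)%N.
    by rewrite prednK// muln_gt0 expn_gt0.
  have gv : g v = l.
    rewrite /g v1 logn2_odd ifT// -ltnS v1.
    rewrite (@leq_trans (N l).*2.+1)//; first by rewrite ltnS -addnn leq_addr.
    by rewrite leq_pmull// expn_gt0.
  have f1 j : (2 ^ v * j.*2.+1).-1.+1 = (2 ^ v * j.*2.+1)%N.
    by rewrite prednK// muln_gt0 expn_gt0.
  exists ((N 0%N).+1.*2.+1 * 2 ^ v.+1)%N, (fun j => (2 ^ v * j.*2.+1).-1).
  split.
    move=> i j ij; rewrite -ltnS !f1 ltn_mul2l expn_gt0/=; lia.
  move=> j; split; first by rewrite /col f1 logn2_odd.
  set s := _.-1; have s1 : (s.+1 <= 2 ^ v.+1 * j.+1)%N.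
    by rewrite f1 expnS -mulnA mulnCA leq_mul2l; lia.
  rewrite (@leq_trans ((N 0%N).+1.*2.+1 * s.+1))%N//; last first.
    by rewrite -mulnA leq_mul2l s1 orbT.
  by have := Slin s; have := Slin s.+1; nia.
Qed.

(** At scale [n] the first [n %/ a] of the points [f j ^ q] are already
    visible. *)
Lemma lower_qdensity_gt0 (R : realType) (q : nat) (M : set nat)
    (a : nat) (f : nat -> nat) :
  (0 < q)%N -> {homo f : i j / (i < j)%N} ->
  (forall j, [/\ (0 < f j)%N, (f j <= a * j.+1)%N & M (f j ^ q)%N]) ->
  (0 < lower_qdensity R q M)%E.
Proof.
move=> q0 fhomo fM.
have a0 : (0 < a)%N by case: (fM 0%N); rewrite muln1; lia.
pose c n := (\sum_(1 <= i < (n ^ q).+1) (i \in M))%N.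
have cn n : (n %/ a <= c n)%N.
  pose s := [seq (f j ^ q)%N | j <- iota 0 (n %/ a)].
  have sU : uniq s.
    rewrite map_inj_uniq ?iota_uniq// => i j /eqP.
    rewrite eqn_exp2r// => /eqP fij.
    by case: (ltngtP i j) => // /fhomo; rewrite fij ltnn.
  have -> : (n %/ a = \sum_(i <- s) (i \in M))%N.
    rewrite big_map (eq_bigr (fun=> 1%N)) ?sum1_size ?size_iota// => j _.
    by rewrite mem_set//; case: (fM j).
  rewrite big_seq_cond (eq_bigl (fun i => i \in s)) => [|i]; last first.
    by rewrite andbT.
  rewrite -big_seq; apply: uniq_sub_le_big => //=.
  + by move=> x y; exact: leq_addr.
  + exact: iota_uniq.
  + move=> _ /mapP[j + ->]; rewrite mem_iota mem_index_iota add0n => /= jn.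
    case: (fM j) => f0 fa _; rewrite expn_gt0 f0/= ltnS leq_exp2r//.
    by rewrite (leq_trans fa)// mulnC -leq_divRL.
apply: (@lt_le_trans _ _ ((2 * a%:R)^-1 : R)%:E).
  by rewrite lte_fin invr_gt0 mulr_gt0// ltr0n.
rewrite /lower_qdensity limn_einf_lim; apply: lime_ge.
  exact: is_cvg_einfs.
near=> n; apply: le_ereal_inf_tmp => _ [m /= nm <-]; rewrite lee_fin.
have am : (a <= m)%N.
  by rewrite (leq_trans _ nm)//; near: n; exact: nbhs_infty_ge.
have m0 : (0 < m)%N by rewrite (leq_trans a0).
rewrite ler_pdivlMr ?ltr0n// ler_pdivrMl ?mulr_gt0 ?ltr0n//.
rewrite -!natrM ler_nat.
have := divn_eq m a; have := ltn_pmod m a0; have := cn m.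
have : (0 < m %/ a)%N by rewrite divn_gt0.
rewrite -/(c m); move: (c m) (m %/ a)%N (m %% a)%N => C d r; nia.
Unshelve. all: by end_near. Qed.

(** * A frequently hypercyclic vector from summable orbits *)

Lemma exp2Vn_lt (R : realType) (k : scalar_kind) (e : scalars R k) :
  0 < e -> exists n : nat, 2^-1 ^+ n < e.
Proof.
have real_case (c : R) : 0 < c -> exists n : nat, 2^-1 ^+ n < c.
  move=> c0; have [n nc] : exists n : nat, c^-1 < n%:R.
    by exists (Num.bound c^-1); rewrite archi_boundP// invr_ge0 ltW.
  exists n; rewrite exprVn invf_plt ?posrE ?exprn_gt0//.
  by rewrite (lt_le_trans nc)// -natrX ler_nat ltnW// ltn_expl.
case: k e => [|] /= e e0; first exact: real_case.
have eE := RRe_real (gtr0_real e0); move: e0.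
rewrite -eE ltcR => /real_case[n ne].
by exists n; move: ne; rewrite -ltcR rmorphXn/= fmorphV rmorph_nat.
Qed.

Definition sequentially_complete (K : numFieldType) (X : normedModType K) :=
  forall z : nat -> X,
  (forall e : K, 0 < e -> exists N, forall n, (N <= n)%N -> `|z n - z N| < e) ->
  exists l : X, z @ \oo --> l.

Lemma cauchy_seq_cvg (K : numFieldType) (X : completeNormedModType K) :
  sequentially_complete X.
Proof.
move=> z zP; apply/cvg_ex/cauchy_cvgP/cauchy_exP => e /zP[N NP].
exists (z N), N => // n /= Nn.
by rewrite -ball_normE /= distrC; exact: NP.
Qed.

Lemma sum_exp2Vn_le (K : numFieldType) (n : nat) :
  \sum_(l < n) (2^-1 : K) ^+ l <= 2.
Proof.
suff -> : \sum_(l < n) (2^-1 : K) ^+ l = 2 - 2 * 2^-1 ^+ n.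
  by rewrite lerBlDr lerDl mulr_ge0// exprn_ge0// invr_ge0.
elim: n => [|n IH]; first by rewrite big_ord0 expr0 mulr1 subrr.
by rewrite big_ord_recr/= IH exprS; field.
Qed.

Section summable_orbits.
Variable K : numFieldType.
Implicit Type X : normedModType K.

(** The body of the q-FHC Criterion for a single vector, for maps that are not
    packaged as bounded operators. *)
Definition summable_orbit X (q : nat) (T : X -> X) (x : X) (u : nat -> X) :=
  [/\ u 0%N = x,
      unconditionally_uniformly (fun r n =>
        if (n <= r)%N then iter (r ^ q - (r - n) ^ q)%N T x else 0),
      unconditionally_uniformly (fun r n => u ((n + r) ^ q - r ^ q)%N),
      forall n, iter (n ^ q) T (u (n ^ q)%N) = x
    & forall n m, (n < m)%N ->
        iter (n ^ q) T (u (m ^ q)%N) = u (m ^ q - n ^ q)%N].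

Lemma unconditionally_uniformly_seq X (a : nat -> nat -> X) :
  unconditionally_uniformly a <->
  forall d : K, 0 < d -> exists N : nat, forall (s : seq nat) (r : nat),
    uniq s -> (forall n, n \in s -> (N <= n)%N) -> `|\sum_(n <- s) a r n| < d.
Proof.
split=> aN d /aN[N HN]; exists N; last first.
  by move=> F r; apply: HN; exact: fset_uniq.
move=> s r sU sN; have := HN [fset n in s]%fset r.
rewrite (perm_big s)/=; last first.
  by apply: uniq_perm => [|//|n]; [exact: fset_uniq|rewrite inE].
by apply=> // n; rewrite inE => /sN.
Qed.

(** Contributions of colours l <= k are controlled by the radius of k, those
    of colours l > k by their own radius; the tolerance 4 ^- m at radius N m
    leaves 2 ^- k * 2 ^- l for colour l, which is summable over l. *)
Lemma grouped_sum_le X (y : nat -> nat -> X) (N : nat -> nat) (k : nat)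
    (s : seq nat) (col gap : nat -> nat) :
  (forall l m, (l <= m)%N -> forall F, uniq F ->
    (forall n, n \in F -> (N m <= n)%N) ->
    `|\sum_(n <- F) y l n| <= 2^-1 ^+ m * 2^-1 ^+ m) ->
  uniq (map gap s) ->
  (forall i, i \in s -> (N k <= gap i)%N /\ (N (col i) <= gap i)%N) ->
  `|\sum_(i <- s) y (col i) (gap i)| <= 2 * 2^-1 ^+ k.
Proof.
move=> yN sU sN; pose L := (\max_(i <- s) col i).+1.
have -> : \sum_(i <- s) y (col i) (gap i) =
    \sum_(l < L) \sum_(i <- s | col i == l) y l (gap i).
  under [RHS]eq_bigr do rewrite big_mkcond/=.
  rewrite exchange_big/= big_seq [RHS]big_seq; apply: eq_bigr => i si.
  have iL : (col i < L)%N by rewrite ltnS; exact: leq_bigmax_seq.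
  rewrite (bigD1 (Ordinal iL))//= eqxx big1 ?addr0// => l lL.
  by case: eqP => // il; case/eqP: lL; exact: val_inj.
apply: (le_trans (ler_norm_sum _ _ _)).
apply: (@le_trans _ _ (\sum_(l < L) 2^-1 ^+ k * 2^-1 ^+ l)); last first.
  by rewrite -mulr_sumr mulrC ler_wpM2r ?exprn_ge0 ?invr_ge0// sum_exp2Vn_le.
apply: ler_sum => l _; rewrite -big_filter -(big_map gap xpredT (y l)).
pose m := maxn l k.
apply: (le_trans (yN l m (leq_maxl _ _) _ _ _)).
- by apply: subseq_uniq sU; apply: map_subseq; exact: filter_subseq.
- move=> _ /mapP[i + ->]; rewrite mem_filter => /andP[/eqP il /sN[iNk iNl]].
  by rewrite /m/maxn; case: ifP => // _; rewrite -il.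
- have h1 : (2^-1 : K) <= 1 by rewrite invf_le1// ler1n.
  by apply: ler_pM; rewrite ?exprn_ge0 ?invr_ge0// ler_wiXn2l ?invr_ge0
    ?leq_maxl ?leq_maxr.
Qed.

End summable_orbits.

Lemma linear_iter_sum (K : numFieldType) (X : normedModType K)
    (T : {linear X -> X}) (m : nat) (I : Type) (s : seq I) (F : I -> X) :
  iter m T (\sum_(i <- s) F i) = \sum_(i <- s) iter m T (F i).
Proof. by elim: m => //= m ->; rewrite linear_sum. Qed.

Lemma linear_iterD (K : numFieldType) (X : normedModType K)
    (T : {linear X -> X}) (m : nat) (x y : X) :
  iter m T (x + y) = iter m T x + iter m T y.
Proof. by elim: m => //= m ->; rewrite linearD. Qed.

Lemma continuous_iter (T : topologicalType) (f : T -> T) (m : nat) :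
  continuous f -> continuous (iter m f).
Proof.
move=> fc; elim: m => [|m IH] x /=; first exact: cvg_id.
by apply: continuous_comp; [exact: IH|exact: fc].
Qed.

(** The frequently hypercyclic vector is z = \sum_s u_(c s) ((p s) ^ q), where
    the p s are separated points with colours c s, and u_l is a backward orbit
    of the target x_l.  If p s0 has colour l then T ^ (p s0 ^ q) maps the s0-th
    term to x_l, the terms before to forward iterates and the terms after to
    backward iterates; separation makes both tails of the two series, hence
    T ^ (p s0 ^ q) z is within a multiple of 2 ^- l of x_l.  Each vector of the
    dense sequence is the target of infinitely many colours. *)
Theorem frequently_hypercyclic_vector (R : realType) (k : scalar_kind)
    (E : normedModType (scalars R k)) (q : nat) (T : {linear E -> E})
    (d : nat -> E) :
  sequentially_complete E ->
  (0 < q)%N -> continuous T ->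
  (forall V : set E, open V -> V !=set0 -> exists i, V (d i)) ->
  (forall i, exists u, summable_orbit q T (d i) u) ->
  exists z : E, forall V : set E, open V -> V !=set0 ->
    (0 < lower_qdensity R q [set n | V (iter n T z)])%E.
Proof.
move=> E_complete q0 Tc d_dense /choice[u0 u0P].
pose h : scalars R k := 2^-1.
have h0 n : 0 < h ^+ n by rewrite exprn_gt0// invr_gt0.
pose x l := d (logn 2 l.+1); pose u l := u0 (logn 2 l.+1).
have uP l : summable_orbit q T (x l) (u l) by exact: u0P.
pose fwd r l n :=
  if (n <= r)%N then iter (r ^ q - (r - n) ^ q)%N T (x l) else 0.
pose bwd r l n := u l ((n + r) ^ q - r ^ q)%N.
have /choice[N NP] : forall m, exists N, forall l, (l <= m)%N -> forall F r,
    uniq F -> (forall n, n \in F -> (N <= n)%N) ->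
    `|\sum_(n <- F) fwd r l n| <= h ^+ m * h ^+ m /\
    `|\sum_(n <- F) bwd r l n| <= h ^+ m * h ^+ m.
  move=> m; have hm : 0 < h ^+ m * h ^+ m by rewrite mulr_gt0.
  have /choice[N1 N1P] : forall l, exists N, forall F r,
      uniq F -> (forall n, n \in F -> (N <= n)%N) ->
      `|\sum_(n <- F) fwd r l n| < h ^+ m * h ^+ m /\
      `|\sum_(n <- F) bwd r l n| < h ^+ m * h ^+ m.
    move=> l; have [_ /unconditionally_uniformly_seq/(_ _ hm)[Na NaP]] := uP l.
    move=> /unconditionally_uniformly_seq/(_ _ hm)[Nb NbP] _ _.
    exists (maxn Na Nb) => F r FU FN.
    by split; [apply: NaP|apply: NbP] => // n /FN; rewrite geq_max => /andP[].
  exists (\max_(l < m.+1) N1 l) => l lm F r FU FN.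
  have [|F1 F2] := N1P l F r FU; last by rewrite !ltW.
  move=> n /FN; apply: leq_trans.
  rewrite -ltnS in lm.
  exact: (@leq_bigmax _ (fun i : 'I_m.+1 => N1 i) (Ordinal lm)).
have [c [p [p_sep p_gt p_freq]]] := separated_colouring N.
have p_mono : {homo p : i j / (i < j)%N} by move=> i j /p_sep[]; lia.
have p_inj : injective p.
  by move=> i j pij; case: (ltngtP i j) => // /p_mono; rewrite pij ltnn.
pose w s := u (c s) (p s ^ q)%N; pose Z n := \sum_(0 <= s < n) w s.
have Zcauchy m n1 n2 :
    (N m <= n1)%N -> (n1 <= n2)%N -> `|Z n2 - Z n1| <= 2 * h ^+ m.
  move=> mn n12; rewrite /Z (big_cat_nat (n := n1))//= addrAC subrr add0r.
  have -> : \sum_(n1 <= s < n2) w s = \sum_(n1 <= s < n2) bwd 0%N (c s) (p s).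
    by apply: eq_bigr => s _; rewrite /bwd addn0 exp0n// subn0.
  apply: (@grouped_sum_le _ _ _ N).
  - by move=> l m' lm F FU FN; have [] := NP _ _ lm F 0%N FU FN.
  - by rewrite map_inj_uniq// iota_uniq.
  - by move=> s; rewrite mem_index_iota => /andP[ns _]; have := p_gt s; lia.
have [z Zz] : exists z : E, Z @ \oo --> z.
  apply: E_complete => e e0.
  have [m me] : exists m, h ^+ m < e / 2 by apply: exp2Vn_lt; rewrite divr_gt0.
  exists (N m) => n mn; rewrite (le_lt_trans (Zcauchy m _ _ _ _))//.
  by rewrite mulrC -ltr_pdivlMr.
have orbit_near s : `|iter (p s ^ q) T z - x (c s)| <= 5 * h ^+ c s.
  pose r := p s; have Zr n : (s < n)%N ->
      `|iter (r ^ q) T (Z n) - x (c s)| <= 4 * h ^+ c s.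
    move=> sn; rewrite /Z (big_cat_nat (n := s))//= ?(ltnW sn)// (big_ltn sn).
    rewrite !linear_iterD !linear_iter_sum /w.
    have [_ _ _ -> _] := uP (c s); rewrite addrCA addrAC subrr add0r.
    rewrite (_ : 4 = 2 + 2 :> scalars R k); last by ring.
    rewrite mulrDl (le_trans (ler_normD _ _))// lerD//.
    - have -> : \sum_(0 <= t < s) iter (r ^ q) T (u (c t) (p t ^ q)%N) =
                \sum_(0 <= t < s) fwd r (c t) (r - p t)%N.
        rewrite big_seq [RHS]big_seq; apply: eq_bigr => t.
        rewrite mem_index_iota => /andP[_ ts]; have [_ _ _ c1 _] := uP (c t).
        have pr : (p t < r)%N by exact: p_mono.
        rewrite /fwd leq_subr subKn ?(ltnW pr)//.
        rewrite -[in RHS](c1 (p t)) -iterD subnK// leq_exp2r// ltnW//.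
      apply: (@grouped_sum_le _ _ _ N).
      + by move=> l m lm F FU FN; have [] := NP _ _ lm F r FU FN.
      + rewrite map_inj_in_uniq ?iota_uniq// => t t'; rewrite !mem_index_iota.
        move=> /andP[_ /p_mono ts] /andP[_ /p_mono ts'] /eqP; rewrite /r.
        by move=> e; apply: p_inj; lia.
      + by move=> t; rewrite mem_index_iota => /andP[_ /p_sep]; rewrite /r; lia.
    - have -> : \sum_(s.+1 <= t < n) iter (r ^ q) T (u (c t) (p t ^ q)%N) =
                \sum_(s.+1 <= t < n) bwd r (c t) (p t - r)%N.
        rewrite big_seq [RHS]big_seq; apply: eq_bigr => t.
        rewrite mem_index_iota => /andP[st _]; have [_ _ _ _ c2] := uP (c t).
        have pr : (r < p t)%N by exact: p_mono.
        by rewrite /bwd subnK ?(ltnW pr)// c2.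
      apply: (@grouped_sum_le _ _ _ N).
      + by move=> l m lm F FU FN; have [] := NP _ _ lm F r FU FN.
      + rewrite map_inj_in_uniq ?iota_uniq// => t t'; rewrite !mem_index_iota.
        move=> /andP[/p_mono ts _] /andP[/p_mono ts' _] /eqP; rewrite /r.
        by move=> e; apply: p_inj; lia.
      + move=> t; rewrite mem_index_iota => /andP[/p_sep + _].
        by rewrite /r; lia.
  have : iter (r ^ q) T \o Z @ \oo --> iter (r ^ q) T z.
    by apply: continuous_cvg => //; exact: continuous_iter.
  move=> /cvgrPdist_lt/(_ _ (h0 (c s)))[n _ nP].
  have := nP (maxn n s.+1) (leq_maxl _ _); set n' := maxn _ _ => zn'.
  rewrite -(subrK (iter (r ^ q) T (Z n')) (iter _ _ z)) -addrA.
  rewrite (le_trans (ler_normD _ _))//.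
  rewrite (_ : 5 = 1 + 4 :> scalars R k); last by ring.
  by rewrite mulrDl mul1r lerD//; [exact: ltW|apply: Zr; exact: leq_maxr].
exists z => V Vo [v Vv].
have [i Vi] := d_dense V Vo (ex_intro _ v Vv).
have /nbhs_ballP[e /= e0 eV] : nbhs (d i) V by exact: open_nbhs_nbhs.
have [m me] : exists m, h ^+ m < e / 5 by apply: exp2Vn_lt; rewrite divr_gt0.
(* a colour with target d i whose tolerance is fine enough *)
pose l := (2 ^ i * m.*2.+1).-1.
have l1 : l.+1 = (2 ^ i * m.*2.+1)%N by rewrite prednK// muln_gt0 expn_gt0.
have xl : x l = d i by rewrite /x l1 logn2_odd.
have ml : (m <= l)%N.
  rewrite -ltnS l1 (@leq_trans m.*2.+1)//.
    by rewrite ltnS -addnn leq_addr.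
  by rewrite leq_pmull// expn_gt0.
have [a [f [f_mono fP]]] := p_freq l.
apply: (@lower_qdensity_gt0 _ _ _ a (p \o f)) => //.
  by move=> i' j' /f_mono/p_mono.
move=> j; have [fl fa] := fP j; split=> //=; first by have := p_gt (f j); lia.
apply: eV; rewrite -ball_normE /= distrC -xl -fl.
apply: (le_lt_trans (orbit_near _)); rewrite fl.
rewrite mulrC -ltr_pdivlMr// (le_lt_trans _ me)// ler_wiXn2l// ?invr_ge0//.
by rewrite invf_le1// ler1n.
Qed.

(** * Riesz representation and adjoints *)

Section scalars_conjugation.
Variables (R : realType) (k : scalar_kind).
Local Notation K := (scalars R k).
Local Notation conj := (@conj_scalar R k).

Lemma of_real_lt (a b : R) : (of_real k a < of_real k b) = (a < b).
Proof. by case: k => //=; rewrite ltcR. Qed.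

Lemma conj_scalarM : {morph conj : x y / x * y}.
Proof. by case: k => x y //=; exact: rmorphM. Qed.

Lemma conj_scalarD : {morph conj : x y / x + y}.
Proof. by case: k => x y //=; exact: rmorphD. Qed.

Lemma conj_scalarN : {morph conj : x / - x}.
Proof. by case: k => x //=; exact: rmorphN. Qed.

Lemma conj_scalarK : involutive conj.
Proof. by case: k => x //=; exact: conjcK. Qed.

Lemma mul_conj_scalar (z : K) : z * conj z = `|z| ^+ 2.
Proof.
case: k z => [|] z /=; first by rewrite real_normK ?num_real.
by rewrite normCK.
Qed.

Lemma norm_conj_scalar (z : K) : `|conj z| = `|z|.
Proof.
apply/eqP; rewrite -(@eqrXn2 _ 2)//; apply/eqP.
by rewrite -mul_conj_scalar conj_scalarK mulrC mul_conj_scalar.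
Qed.

Lemma conj_scalar_ge0 (z : K) : 0 <= z -> conj z = z.
Proof.
case: k z => [|] z //= z0; exact: (geC0_conj z0).
Qed.

Lemma add_conj_scalar_le (z : K) : z + conj z <= 2 * `|z|.
Proof.
rewrite (_ : 2 = 1 + 1 :> K); last by ring.
rewrite mulrDl mul1r -{2}norm_conj_scalar (le_trans _ (ler_normD _ _))//.
apply: real_ler_norm; case: k z => [|] z /=; first exact: num_real.
rewrite addcJ -(rmorph_nat (real_complex R) 2) -rmorphM realE.
by rewrite -(rmorph0 (real_complex R)) !lecR -realE num_real.
Qed.

(** The infimum is formed in the real numbers, of which nonnegative scalars are
    images. *)
Lemma infimum_scalars (T : Type) (G : T -> K) :
  inhabited T -> (forall x, 0 <= G x) ->
  exists m : K, (forall x, m <= G x) /\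
    forall e, 0 < e -> exists x, G x < m + e.
Proof.
move=> [x0] G0; pose A := [set c : R | exists x, of_real k c = G x].
have A_inf : has_inf A.
  split; first by have [c cG] := ge0_of_real (G0 x0); exists c, x0.
  by exists 0 => c [x cx]; rewrite -(of_real_le k) of_real0 cx.
have of_realD (a b : R) : of_real k (a + b) = of_real k a + of_real k b.
  by case: k => //=; exact: rmorphD.
exists (of_real k (inf A)); split=> [x|e e0].
  have [c cx] := ge0_of_real (G0 x); rewrite -cx of_real_le.
  by apply: ge_inf; [case: A_inf|exists x].
have [c ce] := ge0_of_real (ltW e0).
have c0 : 0 < c by rewrite -of_real_lt of_real0 ce.
have [b [x bx] bc] := inf_adherent c0 A_inf.
by exists x; rewrite -bx -ce -of_realD of_real_lt.
Qed.

End scalars_conjugation.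

Section hilbert_space.
Variables (R : realType) (k : scalar_kind).
Local Notation K := (scalars R k).
Local Notation conj := (@conj_scalar R k).
Variable H : completeNormedModType K.
Variable ip : {dot H for conj}.
Hypothesis ip_norm : forall x : H, ip x x = `|x| ^+ 2.

Lemma ipDl z : {morph ip ^~ z : x y / x + y}.
Proof. exact: linearDl. Qed.
Lemma ipBl z : {morph ip ^~ z : x y / x - y}.
Proof. exact: linearBl. Qed.
Lemma ipZl z a x : ip (a *: x) z = a * ip x z.
Proof. exact: linearZl_LR. Qed.
Lemma ipDr z : {morph ip z : x y / x + y}.
Proof. exact: linearDr. Qed.
Lemma ipBr z : {morph ip z : x y / x - y}.
Proof. exact: linearBr. Qed.
Lemma ipZr z a x : ip z (a *: x) = conj a * ip z x.
Proof. exact: linearZr_LR. Qed.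
Lemma ipC x y : ip x y = conj (ip y x).
Proof. by have := @hermitian_subproof _ _ _ _ ip x y; rewrite expr0 mul1r. Qed.

Lemma norm_ipC x y : `|ip x y| = `|ip y x|.
Proof. by rewrite ipC norm_conj_scalar. Qed.

Lemma eq_ipl (x y : H) : (forall z, ip z x = ip z y) -> x = y.
Proof.
move=> xy; apply/eqP; rewrite -subr_eq0 -normr_eq0 -sqrf_eq0 -ip_norm.
by rewrite ipBr xy subrr.
Qed.

Lemma cauchy_schwarz x y : `|ip x y| <= `|x| * `|y|.
Proof.
have [->|y0] := eqVneq y 0.
  by rewrite linear0r !normr0 mulr0.
have n0 : 0 < `|y| ^+ 2 by rewrite exprn_gt0// normr_gt0.
rewrite -(@ler_pXn2r _ 2) ?nnegrE ?mulr_ge0// exprMn.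
have : 0 <= `|(`|y| ^+ 2) *: x - ip x y *: y| ^+ 2 by exact: exprn_ge0.
rewrite -ip_norm ipBl !ipBr !ipZl !ipZr (conj_scalar_ge0 (ltW n0)) !ip_norm.
rewrite (ipC y x).
have := mul_conj_scalar (ip x y); move: (ip x y) (conj _) => c c' cc.
rewrite (_ : _ - _ = `|y| ^+ 2 * (`|x| ^+ 2 * `|y| ^+ 2 - `|c| ^+ 2));
  last first.
  by rewrite -cc; ring.
by rewrite pmulr_rge0// subr_ge0.
Qed.

Lemma ip_separates_norm (x : H) (M : K) :
  0 <= M -> (forall y, `|ip x y| <= M * `|y|) -> `|x| <= M.
Proof.
move=> M0 xM; have [->|x0] := eqVneq x 0; first by rewrite normr0.
have := xM x; rewrite ip_norm ger0_norm ?exprn_ge0// expr2.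
by rewrite ler_pM2r ?normr_gt0.
Qed.

(** A bounded functional phi is represented by the minimiser of
    |x|^2 - 2 Re (phi x): by the parallelogram identity a minimising sequence
    is Cauchy, and the first variation at its limit y in a direction z is
    <z, y> - phi z up to a nonzero factor. *)
Lemma riesz_representation (phi : H -> K) (M : K) :
  (forall x y, phi (x + y) = phi x + phi y) ->
  (forall a x, phi (a *: x) = a * phi x) ->
  0 <= M -> (forall x, `|phi x| <= M * `|x|) ->
  exists y, forall x, phi x = ip x y.
Proof.
move=> phiD phiZ M0 phiM.
have conjD := @conj_scalarD R k; have conjM := @conj_scalarM R k.
(* adding M ^ 2 makes the functional nonnegative *)
pose G x := `|x| ^+ 2 - (phi x + conj (phi x)) + M ^+ 2.
have G0 x : 0 <= G x.
  apply: (@le_trans _ _ ((`|x| - M) ^+ 2)).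
    by rewrite -realEsqr rpredB ?ger0_real.
  rewrite sqrrB /G lerD2r lerD2l lerN2 (le_trans (add_conj_scalar_le _))//.
  by rewrite mulr_natl lerMn2r/= mulrC phiM.
have [m [mG Gm]] := infimum_scalars (inhabits (0 : H)) G0.
pose h : K := 2^-1; have h0 n : 0 < h ^+ n by rewrite exprn_gt0// invr_gt0.
have /choice[x xP] : forall n, exists x, G x < m + h ^+ n * h ^+ n.
  by move=> n; apply: Gm; rewrite mulr_gt0.
have parallelogram a b : `|a - b| ^+ 2 =
    2 * G a + 2 * G b - 4 * G (2^-1 *: (a + b)).
  rewrite /G normrZ exprMn -!ip_norm !(ipBl, ipDl) !(ipBr, ipDr) phiZ !phiD.
  rewrite conjM !conjD [conj 2^-1]conj_scalar_ge0 ?invr_ge0//.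
  rewrite (@ger0_norm _ (2^-1)) ?invr_ge0//.
  by field.
have x_close n i j : (n <= i)%N -> (n <= j)%N -> `|x i - x j| <= 2 * h ^+ n.
  move=> ni nj; rewrite -(@ler_pXn2r _ 2) ?nnegrE ?mulr_ge0 ?(ltW (h0 n))//.
  have Gx l : (n <= l)%N -> G (x l) <= m + h ^+ n * h ^+ n.
    move=> nl; rewrite (le_trans (ltW (xP l)))// lerD2l.
    have hnl : h ^+ l <= h ^+ n.
      by rewrite ler_wiXn2l ?invr_ge0// invf_le1// ler1n.
    by apply: ler_pM => //; rewrite ltW.
  rewrite parallelogram (_ : _ ^+ 2 = 2 * (m + h ^+ n * h ^+ n) +
    2 * (m + h ^+ n * h ^+ n) - 4 * m); last by ring.
  by rewrite lerB ?lerD// ler_pM2l// ?Gx// mG.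
have [y xy] : exists y : H, x @ \oo --> y.
  apply: cauchy_seq_cvg => e e0.
  have [n ne] : exists n, h ^+ n < e / 2 by apply: exp2Vn_lt; rewrite divr_gt0.
  exists n => j nj; rewrite (le_lt_trans (x_close n _ _ _ _))//.
  by rewrite mulrC -ltr_pdivlMr.
exists y => z; apply/eqP; rewrite eq_sym -subr_eq0 -normr_eq0.
apply/eqP/le_anti; rewrite normr_ge0 andbT.
(* length of the step of the variation: t * |z| ^ 2 <= 1 is what matters *)
pose t : K := (`|z| ^+ 2 + 1)^-1.
have t0 : 0 < t by rewrite invr_gt0 ltr_wpDl.
have variation n : `|ip z (x n) - phi z| ^+ 2 * t <= h ^+ n * h ^+ n.
  pose c := ip z (x n) - phi z; pose w := - (t * conj c).
  have cw : conj w = - (t * c).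
    by rewrite /w conj_scalarN conjM conj_scalarK conj_scalar_ge0// ltW.
  have Gw : G (x n + w *: z) = G (x n) - `|c| ^+ 2 * t * (2 - t * `|z| ^+ 2).
    rewrite /G phiD phiZ conjD conjM -!ip_norm !(ipDl, ipDr) !(ipZl, ipZr) cw.
    rewrite (ipC (x n) z) -mul_conj_scalar /w.
    have -> : conj c = conj (ip z (x n)) - conj (phi z).
      by rewrite conjD conj_scalarN.
    by rewrite /c; ring.
  have tz : t * `|z| ^+ 2 <= 1.
    by rewrite /t ler_pdivrMl ?mulr1 ?lerDl// ltr_wpDl.
  have := mG (x n + w *: z); rewrite Gw lerBrDr => /le_lt_trans/(_ (xP n)).
  rewrite ltrD2l => /ltW.
  apply: le_trans; rewrite ler_peMr//; first by rewrite mulr_ge0// ltW.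
  by rewrite lerBrDr (_ : 2 = 1 + 1 :> K) ?lerD2l//; ring.
apply/ler_addgt0Pr => e e0; rewrite add0r.
pose Z := `|z| + 1; have Z0 : 0 < Z by rewrite ltr_wpDl.
pose d := e / 2 / Z; have d0 : 0 < d by rewrite !divr_gt0.
have [n1 n1d] : exists n, h ^+ n < d by exact: exp2Vn_lt.
have /cvgrPdist_lt/(_ _ d0)[n2 _ n2d] := xy.
pose n := maxn n1 n2; have := n2d n (leq_maxr _ _); rewrite /= => xnd.
have hnd : h ^+ n <= d.
  rewrite (le_trans _ (ltW n1d))// ler_wiXn2l ?invr_ge0 ?leq_maxl//.
  by rewrite invf_le1// ler1n.
rewrite -(subrK (ip z (x n)) (ip z y)) -addrA -ipBr.
rewrite (le_trans (ler_normD _ _))// (_ : e = Z * d + Z * d); last first.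
  by rewrite /d [Z * _]mulrC divfK ?gt_eqF// -splitr.
rewrite lerD//.
  by rewrite (le_trans (cauchy_schwarz _ _))// ler_pM ?lerDl// ltW.
rewrite -(@ler_pXn2r _ 2) ?nnegrE ?(mulr_ge0 (ltW Z0) (ltW d0))//.
have := variation n; rewrite ler_pdivrMr ?ltr_wpDl// => /le_trans; apply.
have hn0 := ltW (h0 n).
rewrite exprMn mulrC; apply: ler_pM.
- by rewrite addr_ge0// exprn_ge0.
- by rewrite mulr_ge0.
- by rewrite /Z sqrrD mulr1 expr1n lerD2r lerDl mulrn_wge0.
- by rewrite [leRHS]expr2 ler_pM.
Qed.

(** The value of the adjoint at y represents the functional x |-> <A x, y>. *)
Lemma adjoint_exists (A : bounded_op H) : exists B, is_adjoint ip A B.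
Proof.
have [M M0 AM] := bop_bounded A.
have /choice[B BP] : forall y, exists z, forall x, ip (A x) y = ip x z.
  move=> y; apply: (@riesz_representation (fun x => ip (A x) y) (M * `|y|)).
  - by move=> x x'; rewrite linearD ipDl.
  - by move=> a x; rewrite linearZ ipZl.
  - by rewrite mulr_ge0.
  - by move=> x; rewrite (le_trans (cauchy_schwarz _ _))// mulrAC ler_wpM2r.
have B_bounded : B \in @bounded_linear K H.
  apply/asboolP; split=> [a x y|].
    by apply: eq_ipl => z; rewrite ipDr ipZr -!BP ipDr ipZr.
  exists M => x; apply: ip_separates_norm; first by rewrite mulr_ge0.
  move=> y; rewrite norm_ipC -BP (le_trans (cauchy_schwarz _ _))//.
  by rewrite mulrAC ler_wpM2r.
by exists (BoundedOp B_bounded).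
Qed.

Lemma adjointP (A : bounded_op H) : is_adjoint ip A (adjoint ip A).
Proof. by apply: xgetPex; exact: adjoint_exists. Qed.

Lemma adjointPr (A : bounded_op H) x y : ip x (A y) = ip (adjoint ip A x) y.
Proof. by rewrite ipC adjointP -ipC. Qed.

Lemma norm_adjoint_unitary (U : bounded_op H) x :
  unitary ip U -> `|adjoint ip U x| = `|x|.
Proof.
move=> [UV _]; apply/eqP; rewrite -(@eqrXn2 _ 2)// -!ip_norm.
by rewrite -adjointP UV.
Qed.

Lemma norm_unitary (U : bounded_op H) x : unitary ip U -> `|U x| = `|x|.
Proof.
move=> [_ VU]; apply/eqP; rewrite -(@eqrXn2 _ 2)// -!ip_norm.
by rewrite adjointP VU.
Qed.

End hilbert_space.

(** * Compact operators and finite rank approximation *)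

Lemma compact_net (K : numFieldType) (X : normedModType K) (C : set X) (e : K) :
  compact C -> 0 < e ->
  exists s : seq X, forall x, C x -> exists2 c, c \in s & `|x - c| < e.
Proof.
rewrite compact_cover => cC e0.
have [||D DC CD] := cC X C (fun c => ball c e).
- by move=> c _; exact: ball_open.
- by move=> x Cx; exists x => //; exact: ballxx.
exists (enum_fset D) => x /CD[c cD]; rewrite -ball_normE /= => xc.
by exists c; rewrite // distrC.
Qed.

(** An ultrafilter on the closure contains one ball of each finite cover, so it
    is Cauchy. *)
Lemma totally_bounded_precompact (K : numFieldType)
    (X : completeNormedModType K) (A : set X) :
  (forall e : K, 0 < e ->
    exists s : seq X, forall x, A x -> exists2 c, c \in s & `|x - c| < e) ->
  precompact A.
Proof.
move=> netA; rewrite precompactE compact_ultra => F UF FA.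
have ultra_seq (B : X -> set X) (s : seq X) :
    F (\bigcup_(c in [set` s]) B c) -> exists c, F (B c).
  elim: s => [|c s IH] Fs.
    have [x [c]] : (\bigcup_(c in [set` [::]]) B c) !=set0.
      exact: (@filter_ex _ F _ _ Fs).
    by [].
  have [Fc|Fc] := in_ultra_setVsetC (B c) UF; first by exists c.
  apply: IH; apply: filterS (filterI Fs Fc) => x [[c']] /=.
  by rewrite inE => /predU1P[->//|c's Bc' _]; exists c'.
have Fcauchy : cauchy F.
  apply/cauchy_exP => e e0; have e20 : 0 < e / 2 by rewrite divr_gt0.
  have [s sA] := netA _ e20; apply: (ultra_seq (fun c => ball c e) s).
  apply: filterS FA => x clx.
  have [y [Ay xy]] := clx _ (nbhsx_ballx x _ e20).
  have [c cs yc] := sA y Ay; exists c => //.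
  rewrite (splitr e); apply: (@ball_triangle _ _ y); last exact: ball_sym.
  by rewrite -ball_normE /= distrC.
have /cauchy_cvgP/cvg_ex[l Fl] := Fcauchy.
exists l; split => //.
by apply: (@closed_cvg _ _ F _ id (closure A)) => //; exact: closed_closure.
Qed.

Section scalar_ball.
Variables (R : realType) (k : scalar_kind).
Local Notation K := (scalars R k).

(** In the complex case, a square contains the disc. *)
Lemma scalar_ball_compact (M : K) :
  exists2 C : set K, compact C & forall c : K, `|c| <= M -> C c.
Proof.
have [M0|M0] := boolP (0 <= M); last first.
  exists set0; first exact: compact0.
  by move=> c /(le_trans (normr_ge0 _)) cM; rewrite cM in M0.
have [m mM] := ge0_of_real M0; rewrite -{}mM {M M0}.
have cI : compact `[- m, m] by exact: segment_compact.
case: k => /=.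
  exists `[- m, m]%classic => // c.
  by rewrite ler_norml => cm; rewrite /= in_itv.
exists ((fun z : R * R => (z.1 +i* z.2)%C) @` (`[- m, m] `*` `[- m, m])).
  apply: continuous_compact; last exact: compact_setX.
  apply: continuous_subspaceT => -[a b] A /nbhs_ballP[e /= e0 eA].
  have eE := RRe_real (gtr0_real e0); move: e0 eA; rewrite -eE ltcR => e0 eA.
  have e20 : 0 < complex.Re e / 2 by rewrite divr_gt0.
  exists (ball a (complex.Re e / 2), ball b (complex.Re e / 2)) => /=.
    by split; exact: nbhsx_ballx.
  move=> [a' b'] /= [aa' bb']; apply: eA; rewrite -ball_normE /=.
  move: aa' bb'; rewrite /ball /= => aa' bb'.
  rewrite normc_def /= ltcR -[ltRHS]gtr0_norm// -sqrtr_sqr.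
  rewrite ltr_sqrt ?exprn_gt0//.
  have sq_lt (u : R) :
      `|u| < complex.Re e / 2 -> u ^+ 2 < (complex.Re e / 2) ^+ 2.
    by rewrite -[u ^+ 2]real_normK ?num_real// ltr_pXn2r// nnegrE// ltW.
  rewrite (lt_trans (ltrD (sq_lt _ aa') (sq_lt _ bb')))//.
  by move: e0; move: (complex.Re e) => E E0; nra.
move=> [a b] /= cm; exists (a, b) => //=; move: cm.
rewrite normc_def lecR /= => cm.
have m0 : 0 <= m by rewrite (le_trans _ cm)// sqrtr_ge0.
have {}cm : a ^+ 2 + b ^+ 2 <= m ^+ 2.
  rewrite -[X in X <= _]sqr_sqrtr ?addr_ge0 ?sqr_ge0//.
  by rewrite ler_pXn2r ?nnegrE ?sqrtr_ge0.
rewrite !in_itv/= -!ler_norml; split; rewrite -(@ler_pXn2r _ 2) ?nnegrE//.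
  by rewrite real_normK ?num_real// (le_trans _ cm)// lerDl sqr_ge0.
by rewrite real_normK ?num_real// (le_trans _ cm)// lerDr sqr_ge0.
Qed.
End scalar_ball.

Section compact_operators.
Variables (R : realType) (k : scalar_kind).
Local Notation K := (scalars R k).
Variable H : completeNormedModType K.
Implicit Types S T : compact_op H.

Lemma bop_norm_le (f : bounded_op H) x : `|f x| <= opnorm f * `|x|.
Proof.
have [->|x0] := eqVneq x 0; first by rewrite linear0 !normr0 mulr0.
have nx0 : 0 < `|x| by rewrite normr_gt0.
have := @le_opnorm _ _ _ f (`|x|^-1 *: x).
rewrite linearZ/= !normrZ normfV normr_id mulVf ?gt_eqF// => /(_ (lexx _)).
by rewrite ler_pdivrMl// mulrC.
Qed.

Lemma cop_norm_le S x : `|S x| <= `|S| * `|x|.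
Proof. exact: bop_norm_le. Qed.

Lemma norm_cop_le S (M : K) :
  (forall x : H, `|x| <= 1 -> `|S x| <= M) -> `|S| <= M.
Proof. exact: opnorm_le. Qed.

Lemma cop_sumE (I : Type) (s : seq I) (F : I -> compact_op H) x :
  (\sum_(i <- s) F i : compact_op H) x = \sum_(i <- s) F i x.
Proof.
elim: s => [|i s IH]; first by rewrite !big_nil.
by rewrite !big_cons -IH.
Qed.

Lemma copB S T x : (S - T) x = S x - T x.
Proof. by []. Qed.

(** An operator within e of a compact one maps the unit ball into the
    e-neighbourhood of a compact set, so norm limits of compact operators have
    totally bounded images. *)
Lemma compact_op_complete : sequentially_complete (compact_op H).
Proof.
move=> Z Zc.
have /choice[L ZL] : forall x, exists l : H, (fun n => Z n x) @ \oo --> l.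
  move=> x; apply: cauchy_seq_cvg => e e0.
  have x0 : 0 < `|x| + 1 by rewrite ltr_wpDl.
  have [N NP] := Zc (e / (`|x| + 1)) (divr_gt0 e0 x0).
  exists N => n /NP Zn; rewrite -copB (le_lt_trans (cop_norm_le _ _))//.
  rewrite (@le_lt_trans _ _ (`|Z n - Z N| * (`|x| + 1)))//.
    by rewrite ler_wpM2l// lerDl.
  by rewrite -ltr_pdivlMr.
have LZ e : 0 < e -> exists N, forall n, (N <= n)%N ->
    forall x, `|L x - Z n x| <= e * `|x|.
  move=> e0; have e20 : 0 < e / 2 by rewrite divr_gt0.
  have [N NP] := Zc _ e20; exists N => n Nn x.
  apply/ler_addgt0Pr => d d0.
  have /cvgrPdist_lt/(_ _ d0)[m _ mP] := ZL x.
  have := mP (maxn m N) (leq_maxl _ _); set n' := maxn _ _ => /= Ln'.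
  rewrite -(subrK (Z n' x) (L x)) -addrA addrC (le_trans (ler_normD _ _))//.
  rewrite lerD//; last exact: ltW.
  rewrite -copB (le_trans (cop_norm_le _ _))// ler_wpM2r//.
  rewrite -(subrK (Z N) (Z n')) -addrA (splitr e) (le_trans (ler_normD _ _))//.
  by rewrite lerD// ?(distrC (Z N)) ltW// NP// leq_maxr.
have Llin : linear L.
  move=> a x y; apply: (cvg_unique _ (ZL (a *: x + y))).
    exact: norm_hausdorff.
  have -> : (fun n => Z n (a *: x + y)) = (fun n => a *: Z n x + Z n y).
    by apply/funext => n; rewrite linearP.
  by apply: cvgD; [apply: cvgZr; exact: ZL|exact: ZL].
have Lb : L \in @bounded_linear K H.
  apply/asboolP; split => //; have [N /(_ N (leqnn N)) NP] := LZ 1 ltr01.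
  exists (1 + `|Z N|) => x; rewrite -(subrK (Z N x) (L x)).
  rewrite (le_trans (ler_normD _ _))// mulrDl lerD//; exact: cop_norm_le.
have Lc : BoundedOp Lb \in @compact_operator K H.
  apply/asboolP/totally_bounded_precompact => e e0.
  have e20 : 0 < e / 2 by rewrite divr_gt0.
  have [N /(_ N (leqnn N)) NP] := LZ _ e20.
  have := cop_bopP (Z N) => /asboolP; rewrite precompactE => cZ.
  have [s sP] := compact_net cZ e20; exists s => _ [x /= x1 <-].
  have [|c cs Zc'] := sP (Z N x); first by apply: subset_closure; exists x.
  exists c => //; rewrite -(subrK (Z N x) (L x)) -addrA (splitr e).
  rewrite (le_lt_trans (ler_normD _ _))// ler_ltD// (le_trans (NP x))//.
  by rewrite ler_piMr// ltW.
exists (CompactOp Lc); apply/cvgrPdist_le => e e0.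
have [N NP] := LZ e e0; exists N => // n /= Nn.
apply: norm_cop_le => x x1; rewrite copB (le_trans (NP n Nn x))//.
by rewrite ler_piMr// ltW.
Qed.

End compact_operators.

(** * Rank one operators and density *)

Section rank_one.
Variables (R : realType) (k : scalar_kind).
Local Notation K := (scalars R k).
Local Notation conj := (@conj_scalar R k).
Variable H : completeNormedModType K.
Variable ip : {dot H for conj}.
Hypothesis ip_norm : forall x : H, ip x x = `|x| ^+ 2.

Lemma rank_one_bounded (x y : H) :
  (fun h => ip h y *: x) \in @bounded_linear K H.
Proof.
apply/asboolP; split=> [a u v|].
  by rewrite (ipDl ip) (ipZl ip) scalerDl scalerA.
exists (`|y| * `|x|) => h; rewrite normrZ mulrAC ler_wpM2r//.
by rewrite mulrC (cauchy_schwarz ip_norm).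
Qed.

Lemma rank_one_compact (x y : H) :
  BoundedOp (rank_one_bounded x y) \in @compact_operator K H.
Proof.
have [C cC yC] := scalar_ball_compact `|y|.
apply/asboolP; apply: (@precompactS_compact _ _ _ ((fun c : K => c *: x) @` C)).
  move=> _ [h /= h1 <-]; exists (ip h y) => //; apply: yC.
  by rewrite (le_trans (cauchy_schwarz ip_norm _ _))// ler_piMl.
apply: continuous_compact => //; apply: continuous_subspaceT => c.
exact: (@scalel_continuous K H x c).
Qed.

Definition rank_one (x y : H) : compact_op H :=
  CompactOp (rank_one_compact x y).

Lemma rank_oneE x y h : rank_one x y h = ip h y *: x.
Proof. by []. Qed.

Lemma eq_cop (S T : compact_op H) : (forall x, S x = T x) -> S = T.
Proof. by move=> ST; apply/val_inj/val_inj/funext. Qed.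

Lemma rank_oneBl x x' y : rank_one (x - x') y = rank_one x y - rank_one x' y.
Proof. by apply: eq_cop => h; rewrite copB !rank_oneE scalerBr. Qed.

Lemma rank_oneBr x y y' : rank_one x (y - y') = rank_one x y - rank_one x y'.
Proof. by apply: eq_cop => h; rewrite copB !rank_oneE (ipBr ip) scalerBl. Qed.

Lemma norm_rank_one_le x y : `|rank_one x y| <= `|x| * `|y|.
Proof.
apply: norm_cop_le => h h1; rewrite rank_oneE normrZ mulrC ler_wpM2l//.
by rewrite (le_trans (cauchy_schwarz ip_norm _ _))// ler_piMl.
Qed.

Definition finite_rank (s : seq (H * H)) : compact_op H :=
  \sum_(xy <- s) rank_one xy.1 xy.2.

Lemma finite_rankE s h : finite_rank s h = \sum_(xy <- s) ip h xy.2 *: xy.1.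
Proof. by rewrite /finite_rank cop_sumE. Qed.

(** (x (x) y) T = x (x) T^* y *)
Lemma finite_rank_comp s (T : bounded_op H) : exists s' : seq (H * H),
  forall h, finite_rank s' h = finite_rank s (T h).
Proof.
exists [seq (xy.1, adjoint ip T xy.2) | xy <- s] => h.
rewrite !finite_rankE big_map; apply: eq_bigr => xy _ /=.
by rewrite -(adjointP ip_norm).
Qed.

(** Gram-Schmidt without normalising: with P the projection onto the span of
    the previous vectors and w = d - P d, add the projection onto the line of
    w. *)
Lemma finite_rank_projection (ds : seq H) : exists s,
  [/\ forall d, d \in ds -> finite_rank s d = d,
      forall x y, ip (finite_rank s x) y = ip x (finite_rank s y)
    & forall x, finite_rank s (finite_rank s x) = finite_rank s x].
Proof.
elim: ds => [|d ds [s [sd s_adj s_idem]]].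
  exists [::]; have s0 h : finite_rank [::] h = 0.
    by rewrite finite_rankE big_nil.
  by split=> // *; rewrite !s0 ?linear0r ?linear0l.
pose P := finite_rank s.
have [w wE] : exists w, w = d - P d by exists (d - P d).
have Pw : P w = 0 by rewrite wE linearB/= s_idem subrr.
have [w0|w0] := eqVneq w 0.
  exists s; split=> // d'; rewrite inE => /predU1P[->|/sd//].
  by apply/eqP; rewrite eq_sym -subr_eq0 -/P -wE w0.
have nw : 0 < `|w| ^+ 2 by rewrite exprn_gt0// normr_gt0.
pose c := (`|w| ^+ 2)^-1.
have c_real : conj c = c by rewrite conj_scalar_ge0// invr_ge0 ltW.
exists ((c *: w, w) :: s).
have sE h : finite_rank ((c *: w, w) :: s) h = (c * ip h w) *: w + P h.
  by rewrite finite_rankE big_cons -finite_rankE /= scalerA mulrC.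
have Pip x : ip (P x) w = 0 by rewrite s_adj Pw linear0r.
have cww : c * ip w w = 1 by rewrite ip_norm mulVf// gt_eqF.
have idem x : P (P x) = P x by exact: s_idem.
split=> [d'|x y|x].
- rewrite sE inE => /predU1P[->|d's].
    rewrite (_ : ip d w = ip w w); last by rewrite {2}wE (ipBl ip) Pip subr0.
    by rewrite cww scale1r wE subrK.
  have Pd' : P d' = d' by exact: sd.
  by rewrite -{1}Pd' Pip mulr0 scale0r add0r.
- rewrite !sE (ipDl ip) (ipDr ip) s_adj (ipZl ip) (ipZr ip).
  by rewrite (conj_scalarM) c_real (ipC ip w y) mulrAC -mulrA.
- rewrite !sE linearD linearZ/= Pw scaler0 add0r idem.
  by rewrite (ipDl ip) (ipZl ip) Pip addr0 mulrA mulrAC cww mul1r.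
Qed.

(** The projection onto the span of a net of C: orthogonal projections are
    contractions, so errors are at most twice the mesh. *)
Lemma finite_rank_near_id (C : set H) (e : K) : compact C -> 0 < e ->
  exists s, forall x, C x -> `|x - finite_rank s x| <= e.
Proof.
move=> cC e0; have e20 : 0 < e / 2 by rewrite divr_gt0.
have [ds dsP] := compact_net cC e20.
have [s [sd s_adj s_idem]] := finite_rank_projection ds.
exists s => x /dsP[d dds xd].
have contraction z : `|finite_rank s z| <= `|z|.
  have [->|Pz0] := eqVneq (finite_rank s z) 0; first by rewrite normr0.
  rewrite -(@ler_pM2r _ `|finite_rank s z|) ?normr_gt0// -expr2 -ip_norm.
  rewrite s_adj s_idem (le_trans _ (cauchy_schwarz ip_norm _ _))//.
  rewrite real_ler_norm// -s_idem -s_adj ip_norm.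
  by rewrite ger0_real// exprn_ge0.
rewrite (_ : x - _ = (x - d) - finite_rank s (x - d)); last first.
  by rewrite linearB/= (sd _ dds) opprB addrA subrK.
rewrite (splitr e) (le_trans (ler_normB _ _))// lerD//; first exact: ltW.
by rewrite (le_trans (contraction _))// ltW.
Qed.

(** Compose S with a projection that is close to the identity on the closure of
    the image of the unit ball. *)
Lemma finite_rank_dense (S : compact_op H) (e : K) : 0 < e ->
  exists s, `|S - finite_rank s| <= e.
Proof.
move=> e0; have := cop_bopP S => /asboolP; rewrite precompactE => cS.
have [s sP] := finite_rank_near_id cS e0.
have [s' s'E] := finite_rank_comp s S; exists s'.
apply: norm_cop_le => x x1; rewrite copB s'E; apply: sP.
by apply: subset_closure; exists x.
Qed.

(** Natural numbers encode the finite lists of pairs of indices of a sequence;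
    a number that encodes no list yields 0. *)
Definition finite_rank_seq (v : nat -> H) (i : nat) : compact_op H :=
  \sum_(ab <- odflt [::] (choice.unpickle i : option (seq (nat * nat))))
    rank_one (v ab.1) (v ab.2).

Lemma finite_rank_seq_dense (v : nat -> H) :
  (forall (x : H) (e : K), 0 < e -> exists i, `|x - v i| < e) ->
  forall V : set (compact_op H), open V -> V !=set0 ->
    exists i, V (finite_rank_seq v i).
Proof.
move=> v_dense V Vo [S VS].
have rank_one_dense x y (e : K) : 0 < e ->
    exists a b, `|rank_one x y - rank_one (v a) (v b)| <= e.
  move=> e0; have e20 : 0 < e / 2 by rewrite divr_gt0.
  have y0 : 0 < `|y| + 1 by rewrite ltr_wpDl.
  have [a xa] := v_dense x _ (divr_gt0 e20 y0).
  have a0 : 0 < `|v a| + 1 by rewrite ltr_wpDl.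
  have [b yb] := v_dense y _ (divr_gt0 e20 a0).
  exists a, b; rewrite -(subrK (rank_one (v a) y) (rank_one x y)) -addrA.
  rewrite -rank_oneBl -rank_oneBr (splitr e).
  rewrite (le_trans (ler_normD _ _))// lerD//.
    rewrite (le_trans (norm_rank_one_le _ _))//.
    rewrite (@le_trans _ _ (e / 2 / (`|y| + 1) * (`|y| + 1)))//.
      by rewrite ler_pM ?lerDl// ltW.
    by rewrite divfK// gt_eqF.
  rewrite (le_trans (norm_rank_one_le _ _))//.
  rewrite (@le_trans _ _ ((`|v a| + 1) * (e / 2 / (`|v a| + 1))))//.
    by rewrite ler_pM ?lerDl// ltW.
  by rewrite mulrC divfK// gt_eqF.
have seq_dense (s : seq (H * H)) (e : K) : 0 < e -> exists t : seq (nat * nat),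
    `|finite_rank s - \sum_(ab <- t) rank_one (v ab.1) (v ab.2)| <= e.
  elim: s e => [|[x y] s IH] e e0.
    by exists [::]; rewrite /finite_rank !big_nil subrr normr0 ltW.
  have e20 : 0 < e / 2 by rewrite divr_gt0.
  have [t tP] := IH _ e20; have [a [b abP]] := rank_one_dense x y _ e20.
  exists ((a, b) :: t); rewrite /finite_rank !big_cons /= opprD addrACA.
  by rewrite (splitr e) (le_trans (ler_normD _ _))// lerD.
have /nbhs_ballP[e /= e0 eV] : nbhs S V by exact: open_nbhs_nbhs.
have e20 : 0 < e / 2 / 2 by rewrite !divr_gt0.
have [s sP] := finite_rank_dense S e20; have [t tP] := seq_dense s _ e20.
exists (choice.pickle t); apply: eV.
rewrite -ball_normE /= /finite_rank_seq choice.pickleK /=.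
rewrite -(subrK (finite_rank s) S) -addrA (le_lt_trans (ler_normD _ _))//.
rewrite (le_lt_trans (lerD sP tP))// -splitr.
by rewrite ltr_pdivrMr// ltr_pMr// ltr1n.
Qed.

End rank_one.

(** Approximate each point of a countable dense set by points of D, at all
    dyadic precisions. *)
Lemma separable_dense_seq (R : realType) (k : scalar_kind)
    (H : normedModType (scalars R k)) (D : set H) :
  separable H -> dense D ->
  exists v : nat -> H, (forall i, D (v i)) /\
    forall (x : H) (e : scalars R k), 0 < e -> exists i, `|x - v i| < e.
Proof.
move=> [Q Qc Qd] Dd; pose h : scalars R k := 2^-1.
have h0 n : 0 < h ^+ n by rewrite exprn_gt0// invr_gt0.
have [g gQ] : exists g : nat -> H, forall x, Q x -> exists i, g i = x.
  have /pfcard_geP[Q0|[g]] := Qc; first by exists (fun=> 0) => x; rewrite Q0.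
  by exists g => x /(@surj _ _ _ _ g)[i _ <-]; exists i.
have ballE (x : H) (e : scalars R k) :
    0 < e -> open (ball x e) /\ ball x e !=set0.
  by move=> e0; split; [exact: ball_open|exists x; exact: ballxx].
have /choice[v vP] (i : nat) : exists z, D z /\
    let mn := odflt (0%N, 0%N) (choice.unpickle i) in `|g mn.1 - z| < h ^+ mn.2.
  set mn := odflt _ _; have [bo b0] := ballE (g mn.1) _ (h0 mn.2).
  by have [z []] := Dd _ b0 bo; rewrite -ball_normE /= => gz Dz; exists z.
exists v; split=> [i|x e e0]; first by case: (vP i).
have e20 : 0 < e / 2 by rewrite divr_gt0.
have [bo b0] := ballE x _ e20; have [y []] := Qd _ b0 bo.
rewrite -ball_normE /= => xy /gQ[m gm]; have [n ne] := exp2Vn_lt e20.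
exists (choice.pickle (m, n)); have [_ /=] := vP (choice.pickle (m, n)).
rewrite choice.pickleK /= gm => yv.
rewrite -(subrK y x) -addrA (splitr e) (le_lt_trans (ler_normD _ _))// ltrD//.
exact: lt_trans ne.
Qed.

(** * Summable orbits of rank one operators *)

(** The sum is affine in each coefficient, so its norm over the cube is maximal
    at a vertex.  The translation z makes the induction work: splitting off the
    first term replaces z by z or z + a i. *)
Lemma norm_sum_unit_coef_le (K : numFieldType) (X : normedModType K)
    (I : eqType) (s : seq I) (a : I -> X) (c : I -> K) (d : K) (z : X) :
  (forall s', subseq s' s -> `|z + \sum_(i <- s') a i| <= d) ->
  (forall i, 0 <= c i <= 1) -> `|z + \sum_(i <- s) c i *: a i| <= d.
Proof.
move=> + c01; elim: s z => [|i s IH] z ad.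
  by have := ad [::] isT; rewrite !big_nil.
have [c0 c1] := andP (c01 i); rewrite big_cons.
set S := \sum_(j <- s) _.
rewrite (_ : z + _ = c i *: (z + a i + S) + (1 - c i) *: (z + S)); last first.
  rewrite addrCA [z + a i]addrC -[a i + z + S]addrA scalerDr scalerBl scale1r.
  by rewrite -[RHS]addrA; congr (_ + _); rewrite addrCA subrr addr0.
rewrite (le_trans (ler_normD _ _))// !normrZ !ger0_norm ?subr_ge0//.
rewrite (_ : d = c i * d + (1 - c i) * d); last by ring.
apply: lerD; apply: ler_wpM2l; rewrite ?subr_ge0//; apply: IH => s' s's.
  rewrite -addrA -(big_cons _ _ i s' xpredT a).
  by apply: ad; rewrite /= eqxx.
apply: ad; exact: subseq_trans (subseq_cons _ _).
Qed.

Section bounded_coefficients.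
Variables (R : realType) (k : scalar_kind).
Local Notation K := (scalars R k).

(** Real and imaginary parts, written uniformly for the two scalar fields; for
    real scalars the second direction w' is 0. *)
Lemma cartesian_scalars : exists w w' : K, [/\ `|w| <= 1, `|w'| <= 1 &
  forall z : K, `|z| <= 1 -> exists x y : R,
    [/\ `|x| <= 1, `|y| <= 1 & z = of_real k x * w + of_real k y * w']].
Proof.
case: k => /=.
  exists 1, 0; split; rewrite ?normr0 ?normr1// => z z1.
  by exists z, 0; split; rewrite ?normr0//= mulr1 mulr0 addr0.
exists 1, 'i%C; split; rewrite ?normr1//.
  by rewrite normc_def /= expr0n add0r expr1n sqrtr1.
move=> z z1; exists (complex.Re z), (complex.Im z).
have {}z1 : complex.Re z ^+ 2 + complex.Im z ^+ 2 <= 1.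
  move: z1; case: z => a b; rewrite normc_def lecR /= => z1.
  rewrite -(sqr_sqrtr (addr_ge0 (sqr_ge0 a) (sqr_ge0 b))).
  by rewrite exprn_ile1 ?sqrtr_ge0.
split.
- rewrite -(@ler_pXn2r _ 2) ?nnegrE// real_normK ?num_real// expr1n.
  by rewrite (le_trans _ z1)// lerDl sqr_ge0.
- rewrite -(@ler_pXn2r _ 2) ?nnegrE// real_normK ?num_real// expr1n.
  by rewrite (le_trans _ z1)// lerDr sqr_ge0.
- by rewrite mulr1 mulrC; exact: complexE.
Qed.

(** A scalar of modulus at most 1 is a combination of four numbers in [0, 1],
    the positive and negative parts of its real and imaginary parts. *)
Lemma norm_sum_bounded_coef_le (X : normedModType K) (I : eqType) (s : seq I)
    (a : I -> X) (c : I -> K) (M d : K) :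
  (forall s', subseq s' s -> `|\sum_(i <- s') a i| <= d) ->
  0 <= M -> (forall i, `|c i| <= M) -> `|\sum_(i <- s) c i *: a i| <= 4 * M * d.
Proof.
move=> ad M0 cM.
have d0 : 0 <= d by rewrite (le_trans _ (ad [::] (sub0seq _))).
have real_coef (x : I -> R) : (forall i, `|x i| <= 1) ->
    `|\sum_(i <- s) of_real k (x i) *: a i| <= d + d.
  move=> x1.
  have part (y : I -> R) : (forall i, 0 <= y i <= 1) ->
      `|\sum_(i <- s) of_real k (y i) *: a i| <= d.
    move=> y01; rewrite -[X in `|X|]add0r; apply: norm_sum_unit_coef_le.
      by move=> s' s's; rewrite add0r; exact: ad.
    move=> i; have := y01 i; rewrite -!(of_real_le k) of_real0.
    by have -> : of_real k 1 = 1 :> K by case: k.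
  rewrite (_ : \sum_(i <- s) _ =
    \sum_(i <- s) of_real k ((`|x i| + x i) / 2) *: a i -
    \sum_(i <- s) of_real k ((`|x i| - x i) / 2) *: a i).
    rewrite (le_trans (ler_normB _ _))// lerD// part// => i.
      by have := x1 i; rewrite ler_norml => /andP[]; case: (ler0P (x i)); lra.
    by have := x1 i; rewrite ler_norml => /andP[]; case: (ler0P (x i)); lra.
  rewrite -sumrB; apply: eq_bigr => i _; rewrite -scalerBl; congr (_ *: _).
  have of_realB (b b' : R) : of_real k b - of_real k b' = of_real k (b - b').
    by case: k => //=; rewrite rmorphB.
  by rewrite of_realB; congr of_real; lra.
have unit_coef (z : I -> K) : (forall i, `|z i| <= 1) ->
    `|\sum_(i <- s) z i *: a i| <= 4 * d.
  move=> z1; have [w [w' [w1 w'1 zE]]] := cartesian_scalars.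
  have /choice[x /choice[y xyP]] := fun i => zE _ (z1 i).
  rewrite (_ : \sum_(i <- s) _ = w *: (\sum_(i <- s) of_real k (x i) *: a i) +
    w' *: (\sum_(i <- s) of_real k (y i) *: a i)); last first.
    rewrite !scaler_sumr -big_split; apply: eq_bigr => i _ /=.
    have [_ _ {1}->] := xyP i.
    by rewrite scalerDl !scalerA mulrC [X in _ + X *: _]mulrC.
  rewrite (_ : 4 * d = (d + d) + (d + d)); last by ring.
  rewrite (le_trans (ler_normD _ _))// !normrZ; apply: lerD.
    by rewrite -[leRHS]mul1r ler_pM// real_coef// => i; case: (xyP i).
  by rewrite -[leRHS]mul1r ler_pM// real_coef// => i; case: (xyP i).
have [M_eq0|Mn0] := eqVneq M 0.
  rewrite big1 ?normr0 ?mulr_ge0// => i _; have := cM i.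
  by rewrite M_eq0 normr_le0 => /eqP ->; rewrite scale0r.
have Mp : 0 < M by rewrite lt_neqAle eq_sym Mn0.
rewrite (_ : \sum_(i <- s) _ = M *: (\sum_(i <- s) (M^-1 * c i) *: a i)).
  rewrite normrZ ger0_norm// (_ : 4 * M * d = M * (4 * d)); last by ring.
  rewrite ler_wpM2l// unit_coef// => i.
  by rewrite normrM ger0_norm ?invr_ge0// ler_pdivrMl// mulr1.
by rewrite scaler_sumr; apply: eq_bigr => i _; rewrite scalerA mulVKf.
Qed.

End bounded_coefficients.

(** What the second factors of rank one operators must satisfy: mere
    boundedness replaces summability, as for an isometry. *)
Definition tail_bounded (K : numFieldType) (X : normedModType K)
    (b : nat -> nat -> X) :=
  exists M N, 0 <= M /\ forall r n, (N <= n)%N -> `|b r n| <= M.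

Definition bounded_orbit (K : numFieldType) (X : normedModType K) (q : nat)
    (T : X -> X) (y : X) (v : nat -> X) :=
  [/\ v 0%N = y,
      tail_bounded (fun r n =>
        if (n <= r)%N then iter (r ^ q - (r - n) ^ q)%N T y else 0),
      tail_bounded (fun r n => v ((n + r) ^ q - r ^ q)%N),
      forall n, iter (n ^ q) T (v (n ^ q)%N) = y
    & forall n m, (n < m)%N ->
        iter (n ^ q) T (v (m ^ q)%N) = v (m ^ q - n ^ q)%N].

Lemma unconditionally_tail_bounded (K : numFieldType) (X : normedModType K)
    (a : nat -> nat -> X) : unconditionally_uniformly a -> tail_bounded a.
Proof.
move=> /unconditionally_uniformly_seq/(_ 1 ltr01)[N NP]; exists 1, N.
split=> // r n Nn; have := NP [:: n] r isT.
rewrite big_seq1 => /(_ _)/ltW; apply.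
by move=> m; rewrite inE => /eqP ->.
Qed.

Lemma summable_bounded_orbit (K : numFieldType) (X : normedModType K) (q : nat)
    (T : X -> X) x u : summable_orbit q T x u -> bounded_orbit q T x u.
Proof.
by move=> [? ? ? ? ?]; split=> //; exact: unconditionally_tail_bounded.
Qed.

Lemma unconditionally_uniformlyD (K : numFieldType) (X : normedModType K)
    (a b : nat -> nat -> X) :
  unconditionally_uniformly a -> unconditionally_uniformly b ->
  unconditionally_uniformly (fun r n => a r n + b r n).
Proof.
move=> aP bP d d0; have d20 : 0 < d / 2 by rewrite divr_gt0.
have [[N NP] [N' NP']] := (aP _ d20, bP _ d20); exists (maxn N N') => F r FN.
rewrite big_split/= (splitr d) (le_lt_trans (ler_normD _ _))// ltrD//.
  by apply: NP => n /FN; rewrite geq_max => /andP[].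
by apply: NP' => n /FN; rewrite geq_max => /andP[].
Qed.

Lemma summable_orbit0 (K : numFieldType) (X : normedModType K) (q : nat)
    (T : {linear X -> X}) : summable_orbit q T 0 (fun=> 0).
Proof.
have T0 n : iter n T 0 = 0 by elim: n => //= n ->; exact: linear0.
split=> // d d0; exists 0%N => F r _; rewrite big1 ?normr0// => n _.
by rewrite T0 if_same.
Qed.

Lemma summable_orbitD (K : numFieldType) (X : normedModType K) (q : nat)
    (T : {linear X -> X}) x y u v :
  summable_orbit q T x u -> summable_orbit q T y v ->
  summable_orbit q T (x + y) (fun n => u n + v n).
Proof.
move=> [u0 ua ub uc ud] [v0 va vb vc vd]; split.
- by rewrite u0 v0.
- have := unconditionally_uniformlyD ua va; congr unconditionally_uniformly.
  apply/funext => r; apply/funext => n.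
  by case: ifP; rewrite ?addr0// linear_iterD.
- exact: unconditionally_uniformlyD.
- by move=> n; rewrite linear_iterD uc vc.
- by move=> n m nm; rewrite linear_iterD ud// vd.
Qed.

Section rank_one_orbits.
Variables (R : realType) (k : scalar_kind).
Local Notation K := (scalars R k).
Variable H : completeNormedModType K.
Variable ip : {dot H for @conj_scalar R k}.
Hypothesis ip_norm : forall x : H, ip x x = `|x| ^+ 2.
Local Notation rank_one := (rank_one ip_norm).

(** At a vector h of norm at most 1 the sum of the rank one operators is the sum
    of the a r n with coefficients <h, b r n>, bounded by M. *)
Lemma rank_one_unconditionally (a b : nat -> nat -> H) :
  unconditionally_uniformly a -> tail_bounded b ->
  unconditionally_uniformly (fun r n => rank_one (a r n) (b r n)).
Proof.
move=> /unconditionally_uniformly_seq aP [M [N [M0 bM]]].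
apply/unconditionally_uniformly_seq => d d0.
have M1 : 0 < M + 1 by rewrite ltr_wpDl.
pose e := d / 2 / (4 * (M + 1)).
have c0 : 0 < 4 * (M + 1) by rewrite mulr_gt0.
have e0 : 0 < e by rewrite !divr_gt0.
have [N' aN'] := aP _ e0; exists (maxn N N') => s r sU sN.
apply: (@le_lt_trans _ _ (d / 2)); last first.
  by rewrite ltr_pdivrMr// ltr_pMr// ltr1n.
apply: norm_cop_le => h h1; rewrite cop_sumE.
rewrite (_ : d / 2 = 4 * (M + 1) * e); last first.
  by rewrite /e [RHS]mulrC divfK// gt_eqF.
rewrite (eq_big_seq
  (fun n => (if (N <= n)%N then ip h (b r n) else 0) *: a r n)).
  apply: norm_sum_bounded_coef_le; last 2 first.
  - exact: ltW.
  - move=> n; case: ifP => [Nn|_]; last by rewrite normr0 ltW.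
    rewrite (le_trans (cauchy_schwarz ip_norm _ _))//.
    apply: (@le_trans _ _ (1 * M)); first by rewrite ler_pM// bM.
    by rewrite mul1r lerDl.
  move=> s' s's; rewrite ltW// aN' ?(subseq_uniq s's)// => n.
  move=> /(mem_subseq s's)/sN.
  by rewrite geq_max => /andP[].
by move=> n /sN; rewrite geq_max => /andP[-> _]; rewrite rank_oneE.
Qed.

Lemma rank_one_orbit (q : nat) (A B : bounded_op H)
    (C : compact_op H -> compact_op H) x y u v :
  (forall x y, C (rank_one x y) = rank_one (A x) (B y)) ->
  summable_orbit q A x u -> bounded_orbit q B y v ->
  summable_orbit q C (rank_one x y) (fun n => rank_one (u n) (v n)).
Proof.
move=> CE [u0 ua ub uc ud] [v0 va vb vc vd].
have iterC n x' y' :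
    iter n C (rank_one x' y') = rank_one (iter n A x') (iter n B y').
  by elim: n => //= n ->; rewrite CE.
split.
- by rewrite u0 v0.
- have := rank_one_unconditionally ua va; congr unconditionally_uniformly.
  apply/funext => r; apply/funext => n; case: ifP => // _.
  by apply: eq_cop => h; rewrite rank_oneE scaler0.
- exact: rank_one_unconditionally.
- by move=> n; rewrite iterC uc vc.
- by move=> n m nm; rewrite iterC ud// vd.
Qed.

(** Powers of U run the orbits of the adjoint backwards, isometrically. *)
Lemma unitary_bounded_orbit (q : nat) (U : bounded_op H) y : (0 < q)%N ->
  unitary ip U -> bounded_orbit q (adjoint ip U) y (fun n => iter n U y).
Proof.
move=> q0 Uu; have [_ VU] := Uu.
have normU n z : `|iter n U z| = `|z|.
  by elim: n => //= n; rewrite (norm_unitary ip_norm).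
have normV n z : `|iter n (adjoint ip U) z| = `|z|.
  by elim: n => //= n; rewrite (norm_adjoint_unitary ip_norm).
have VUiter n m z : iter n (adjoint ip U) (iter (n + m) U z) = iter m U z.
  by elim: n => //= n IH; rewrite -iterS iterSr VU.
split=> //.
- by exists `|y|, 0%N; split=> // r n _; case: ifP; rewrite ?normV// normr0.
- by exists `|y|, 0%N; split=> // r n _; rewrite normU.
- by move=> n; have := VUiter (n ^ q)%N 0%N y; rewrite addn0.
- move=> n m nm; rewrite -[in LHS](@subnKC (n ^ q) (m ^ q)) ?VUiter//.
  by rewrite leq_exp2r// ltnW.
Qed.

End rank_one_orbits.

(** * Multiplication operators *)

Section multipliers.
Variables (R : realType) (k : scalar_kind).
Local Notation K := (scalars R k).
Variable H : completeNormedModType K.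
Implicit Types A B : bounded_op H.

Lemma mult_compact_linear A B : linear (mult_compact A B).
Proof.
move=> a S T; apply: eq_cop => h /=.
by rewrite (linearP A).
Qed.

HB.instance Definition _ A B := GRing.isLinear.Build K (compact_op H)
  (compact_op H) *:%R (mult_compact A B) (mult_compact_linear A B).

Lemma mult_compact_continuous A B : continuous (mult_compact A B).
Proof.
have [[M M0 AM] [N N0 BN]] := (bop_bounded A, bop_bounded B).
apply: bounded_linear_continuous.
apply/ex_bound; exists (M * N); apply/nbhs_ballP; exists 1 => //= S.
rewrite -ball_normE /= sub0r normrN => S1.
apply: norm_cop_le => h h1 /=; rewrite (le_trans (AM _))// ler_wpM2l//.
rewrite (le_trans (cop_norm_le _ _))// -[leRHS]mul1r.
apply: ler_pM => //; first exact: ltW.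
by rewrite (le_trans (BN _))// ler_piMr.
Qed.

Lemma mult_cot_linear A B : linear (mult_cot A B : cot_op H -> cot_op H).
Proof.
move=> a S T; apply/val_inj/funext => h.
exact: (linearP A a (bop_fun S (B h)) (bop_fun T (B h))).
Qed.

Lemma mult_cot_continuous A B :
  continuous (mult_cot A B : cot_op H -> cot_op H).
Proof.
move=> f V /cot_nbhsP[C [e [cC e0] CV]]; have [M M0 AM] := bop_bounded A.
have M1 : 0 < M + 1 by rewrite ltr_wpDl.
apply/cot_nbhsP; exists (B @` C), (e / (M + 1)).
  split; last by rewrite divr_gt0.
  apply: continuous_compact => //; apply: continuous_subspaceT.
  exact: bop_continuous.
move=> g fg; apply: CV => x Cx /=.
rewrite -(linearB A) (le_lt_trans (AM _))//.
apply: (@le_lt_trans _ _ ((M + 1) * `|f (B x) - g (B x)|)).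
  by rewrite ler_wpM2r// lerDl.
by rewrite mulrC -ltr_pdivlMr//; apply: fg; exists x.
Qed.

Definition cot_of_compact (S : compact_op H) : cot_op H := cop_bop S.

Lemma cot_of_compact_continuous : continuous cot_of_compact.
Proof.
move=> S V /cot_nbhsP[C [e [cC e0] CV]].
have [M M0 CM] := compact_norm_le cC.
apply/nbhs_ballP; exists (e / M) => /=; first by rewrite divr_gt0.
move=> T; rewrite -ball_normE /= => ST; apply: CV => x Cx.
rewrite /cot_of_compact -copB (le_lt_trans (cop_norm_le _ _))//.
rewrite (@le_lt_trans _ _ (`|S - T| * M))// ?ler_wpM2l ?CM//.
by rewrite -ltr_pdivlMr.
Qed.

Variable ip : {dot H for @conj_scalar R k}.
Hypothesis ip_norm : forall x : H, ip x x = `|x| ^+ 2.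

(** On a compact set C, f is close to P f for a finite rank projection P that is
    close to the identity on the image of C. *)
Lemma cot_of_compact_dense (V : set (cot_op H)) : open V -> V !=set0 ->
  exists S, V (cot_of_compact S).
Proof.
move=> Vo [f Vf].
have /cot_nbhsP[C [e [cC e0] CV]] : nbhs f V by exact: open_nbhs_nbhs.
have cfC : compact (f @` C).
  apply: continuous_compact => //; apply: continuous_subspaceT.
  exact: (@bop_continuous _ _ f).
have e20 : 0 < e / 2 by rewrite divr_gt0.
have [s sP] := finite_rank_near_id ip_norm cfC e20.
have [s' s'E] := finite_rank_comp ip_norm s f.
exists (finite_rank ip_norm s'); apply: CV => x Cx /=.
rewrite /cot_of_compact s'E; apply: (@le_lt_trans _ _ (e / 2)).
  by apply: sP; exists x.
by rewrite ltr_pdivrMr// ltr_pMr// ltr1n.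
Qed.

(** If A has summable orbits and the adjoint B' of B has bounded ones on a
    dense set D, rank one operators with factors in D have summable orbits
    under S |-> A S B, which sends the rank one operator of (x, y) to that of
    (A x, B' y). *)
Lemma mult_frequently_hypercyclic (q : nat) (A B B' : bounded_op H)
    (D : set H) :
  (0 < q)%N -> separable H -> dense D ->
  (forall x, D x -> exists u, summable_orbit q A x u) ->
  (forall x y, ip (B x) y = ip x (B' y)) ->
  (forall y, D y -> exists v, bounded_orbit q B' y v) ->
  q_frequently_hypercyclic R q (mult_compact A B) /\
  q_frequently_hypercyclic R q (mult_cot A B : cot_op H -> cot_op H).
Proof.
move=> q0 Hsep Dd Au BB' Bv.
have [d [dD d_dense]] := separable_dense_seq Hsep Dd.
have mult_rank_one x y : mult_compact A B (rank_one ip_norm x y) =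
    rank_one ip_norm (A x) (B' y).
  by apply: eq_cop => h; rewrite /= linearZ/= BB'.
have orbits i : exists u,
    summable_orbit q (mult_compact A B) (finite_rank_seq ip_norm d i) u.
  rewrite /finite_rank_seq; elim: (odflt _ _) => [|[a b] t [u uP]].
    by exists (fun=> 0); rewrite big_nil; exact: summable_orbit0.
  have [[x xP] [y yP]] := (Au _ (dD a), Bv _ (dD b)).
  rewrite big_cons; eexists; apply: summable_orbitD uP => /=.
  exact: (rank_one_orbit mult_rank_one xP yP).
have [z zP] := frequently_hypercyclic_vector (@compact_op_complete R k H) q0
  (@mult_compact_continuous A B) (finite_rank_seq_dense ip_norm d_dense) orbits.
split; split.
- exact: mult_compact_linear.
- exact: mult_compact_continuous.
- by exists z.
- exact: mult_cot_linear.
- exact: mult_cot_continuous.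
exists (cot_of_compact z) => V Vo V0.
have iterE n : iter n (mult_cot A B : cot_op H -> cot_op H) (cot_of_compact z) =
    cot_of_compact (iter n (mult_compact A B) z).
  by elim: n => //= n ->.
rewrite (_ : [set n | _] =
  [set n | (cot_of_compact @^-1` V) (iter n (mult_compact A B) z)]); last first.
  by apply/seteqP; split=> n; rewrite /= iterE.
apply: zP; last by have [S VS] := cot_of_compact_dense Vo V0; exists S.
by apply: open_comp => // S _; exact: cot_of_compact_continuous.
Qed.

End multipliers.

Theorem corollary3p9 (R : realType) (k : scalar_kind)
    (H : completeNormedModType (scalars R k))
    (ip : {dot H for @conj_scalar R k})
    (ip_norm : forall x : H, ip x x = `|x| ^+ 2)
    (H_separable : separable H)
    (q : nat) (q_gt0 : (0 < q)%N)
    (A : bounded_op H) (A_criterion : qFHC_criterion q A)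
    (U : bounded_op H) (U_unitary : unitary ip U) :
  [/\ q_frequently_hypercyclic R q
        (mult_compact A (adjoint ip A) : compact_op H -> compact_op H),
      q_frequently_hypercyclic R q
        (mult_compact A U : compact_op H -> compact_op H),
      q_frequently_hypercyclic R q
        (mult_cot A (adjoint ip A) : cot_op H -> cot_op H)
    & q_frequently_hypercyclic R q
        (mult_cot A U : cot_op H -> cot_op H)].
Proof.
have [D Dd DA] := A_criterion.
have A_orbit x : D x -> exists u, summable_orbit q A x u by exact: DA.
have [conj_K conj_L] := mult_frequently_hypercyclic ip_norm q_gt0 H_separable Dd
  A_orbit (fun x y => esym (adjointPr ip_norm A x y))
  (fun y Dy => let: ex_intro u uP := A_orbit y Dy in
     ex_intro _ u (summable_bounded_orbit uP)).
have [unit_K unit_L] := mult_frequently_hypercyclic ip_norm q_gt0 H_separable Dd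
  A_orbit (fun x y => adjointP ip_norm U x y)
  (fun y _ => ex_intro _ _ (unitary_bounded_orbit ip_norm y q_gt0 U_unitary)).
by split.
Qed.
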